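(* For every strongly continuous one-parameter semigroup $(C_t)_{t\ge0}$ of hermitian contractions on a Hilbert space $\mathcal H$, there exists a euclidean realization $(U_t)_{t\in\mathbb R}$ of Markov type on a reflection positive Hilbert space $(\mathcal E,\mathcal E_+,\theta)$ with $\mathcal E_0$ cyclic in $\mathcal E$ (for $U$) and $\mathcal E_+$ equal to the closed linear span of $\bigcup_{t>0}U_t\mathcal E_0$. Any realization with these two properties is equivalent to the minimal unitary dilation obtained by the $B(\mathcal H)$-valued positive definite function $\psi(t):=C_{|t|}$ on $\mathbb R$.
   Context: A reflection positive Hilbert space is a triple $(\mathcal E,\mathcal E_+,\theta)$ with $\mathcal E$ a Hilbert space, $\theta$ a unitary involution and $\mathcal E_+$ a closed subspace with $\langle\eta,\theta\eta\rangle\ge0$ for $\eta\in\mathcal E_+$. With $\mathcal N=\{\eta\in\mathcal E_+:\langle\eta,\theta\eta\rangle=0\}$, $\hat{\mathcal E}$ is the completion of $\mathcal E_+/\mathcal N$ for the norm $\|\hat\eta\|=\langle\eta,\theta\eta\rangle^{1/2}$ and $q:\mathcal E_+\to\hat{\mathcal E}$, $\eta\mapsto\hat\eta$. Put $\mathcal E_0=\{\xi\in\mathcal E_+:\theta\xi=\xi\}$. The space is of Markov type if $P_+P_0P_-=P_+P_-$, where $P_0,P_\pm$ are the orthogonal projections onto $\mathcal E_0$, $\mathcal E_+$ and $\mathcal E_-:=\theta(\mathcal E_+)$ (equivalently $q(\mathcal E_0)=\hat{\mathcal E}$). A reflection positive unitary one-parameter group on $(\mathcal E,\mathcal E_+,\theta)$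 is a strongly continuous unitary one-parameter group $(U_t)$ with $U_t\mathcal E_+\subseteq\mathcal E_+$ for $t>0$ and $\theta U_t\theta=U_{-t}$; it induces a strongly continuous semigroup $(\hat U_t)_{t\ge0}$ of symmetric contractions on $\hat{\mathcal E}$ by $\hat U_t\hat\eta=\widehat{U_t\eta}$. It is a euclidean realization of $(C,\mathcal H)$ if $(\hat U,\hat{\mathcal E})$ is unitarily equivalent to $(C,\mathcal H)$; it is of Markov type if $(\mathcal E,\mathcal E_+,\theta)$ is. $\mathcal E_0$ is cyclic if $\bigcup_{t\in\mathbb R}U_t\mathcal E_0$ spans a dense subspace of $\mathcal E$. Minimal unitary dilation: for $\psi(t)=C_{|t|}$ the kernel $K(s,t)=\psi(s-t)$ is positive definite; $\mathcal H_\psi\subseteq\mathcal H^{\mathbb R}$ denotes the Hilbert space of $\mathcal H$-valued functions on $\mathbb R$ with reproducing kernel $K$ (point evaluations $\mathrm{ev}_s$ are continuous and $\mathrm{ev}_s\mathrm{ev}_t^*=K(s,t)$). The minimal unitary dilation of $C$ is the unitary representation $(U^\psi_tf)(s)=f(s+t)$ of $\mathbb R$ on $\mathcal H_\psi$; here $\mathcal H$ is identified with $\mathrm{ev}_0^*\mathcal H\subseteq\mathcal H_\psi$, and the involution is $(\theta f)(s)=f(-s)$. *)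

(* Defs.v *)
From HB Require Import structures.
From mathcomp Require Import all_boot all_order all_algebra.
From mathcomp Require Import complex.
From mathcomp Require Import all_classical all_reals all_analysis.

Set Implicit Arguments.
Unset Strict Implicit.
Unset Printing Implicit Defensive.

Import Order.TTheory GRing.Theory Num.Theory.
Import numFieldNormedType.Exports.

Local Open Scope classical_set_scope.
Local Open Scope ring_scope.

(* The library's inner product forms are linear in the first argument. *)
HB.mixin Record CompleteNormedModule_isHilbert (R : realType) E
    of CompleteNormedModule R[i] E := {
  hdot : {dot E for Num.conj};
  hdotE : forall x : E, `|x| ^+ 2 = hdot x x
}.

#[short(type="hilbertType")]
HB.structure Definition Hilbert (R : realType) :=
  {E of CompleteNormedModule R[i] E & CompleteNormedModule_isHilbert R E}.

Notation "'[< x , y >]" := (hdot x y) : ring_scope.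

Definition lspan (K : numFieldType) (E : normedModType K) (A : set E) : set E :=
  smallest (fun S : set E => submod_closed [in S]) A.

Section HilbertSpaces.
Variable R : realType.

Definition unitary (E F : hilbertType R) (f : {linear E -> F}) : Prop :=
  (forall x y, '[< f x, f y >] = '[< x, y >]) /\ bijective f.

(* On a closed subspace such a y exists and is unique. *)
Definition orthoproj (E : hilbertType R) (A : set E) (x : E) : E :=
  get [set y | A y /\ forall z, A z -> '[< x - y, z >] = 0].

Definition adjoint (E F : hilbertType R) (f : {linear E -> F})
    (g : {linear F -> E}) : Prop :=
  forall x y, '[< f x, y >] = '[< x, g y >].

(* The index ranges over all of R, but only t >= 0 is constrained. *)
Record contraction_semigroup (H : hilbertType R) (C : R -> {linear H -> H}) :
    Prop := {
  contraction_semigroup0 : forall x, C 0 x = x;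
  contraction_semigroupD : forall s t x, 0 <= s -> 0 <= t ->
    C (s + t) x = C s (C t x);
  contraction_semigroup_hermitian : forall t, 0 <= t -> adjoint (C t) (C t);
  contraction_semigroup_contraction : forall t x, 0 <= t -> `|C t x| <= `|x|;
  contraction_semigroup_continuous : forall x,
    {within `[0, +oo[, continuous (fun t => C t x)}
}.

Record unitary_group (E : hilbertType R) (U : R -> {linear E -> E}) : Prop := {
  unitary_group_unitary : forall t, unitary (U t);
  unitary_group0 : forall x, U 0 x = x;
  unitary_groupD : forall s t x, U (s + t) x = U s (U t x);
  unitary_group_continuous : forall x, continuous (fun t => U t x)
}.

Record rp_space := RpSpace {
  rp_sort :> hilbertType R;
  rp_plus : set rp_sort;
  rp_theta : {linear rp_sort -> rp_sort};
  rp_plus_submod : submod_closed [in rp_plus];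
  rp_plus_closed : closed rp_plus;
  rp_theta_unitary : unitary rp_theta;
  rp_thetaK : involutive rp_theta;
  rp_positive : forall x, rp_plus x -> 0 <= '[< x, rp_theta x >]
}.

Arguments rp_plus : clear implicits.
Arguments rp_theta : clear implicits.

Definition rp_minus (X : rp_space) : set X := rp_theta X @` rp_plus X.

Definition rp_zero (X : rp_space) : set X :=
  [set x | rp_plus X x /\ rp_theta X x = x].

Arguments rp_minus : clear implicits.
Arguments rp_zero : clear implicits.

Definition markov_type (X : rp_space) : Prop :=
  let P0 := orthoproj (rp_zero X) in
  let Pp := orthoproj (rp_plus X) in
  let Pm := orthoproj (rp_minus X) in
  forall x, Pp (P0 (Pm x)) = Pp (Pm x).

(* A completion of rp_plus X / N, presented as a complete space with a map
   from rp_plus X that is linear, has dense range and pulls the norm back to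
   the seminorm |<x, theta x>|^(1/2), whose null space is N.  The values of
   os_q outside rp_plus X are irrelevant. *)
Record os_quotient (X : rp_space) := OsQuotient {
  os_sort :> hilbertType R;
  os_q : X -> os_sort;
  os_q_linear : forall (a : R[i]) x y, rp_plus X x -> rp_plus X y ->
    os_q (a *: x + y) = a *: os_q x + os_q y;
  os_q_norm : forall x, rp_plus X x ->
    `|os_q x| = sqrtC '[< x, rp_theta X x >];
  os_q_dense : closure (os_q @` rp_plus X) = setT
}.

Arguments os_q {X} Q _ : rename.

Record rp_unitary_group (X : rp_space) (U : R -> {linear X -> X}) : Prop := {
  rp_unitary_group_group : unitary_group U;
  rp_unitary_group_plus : forall t x, 0 < t -> rp_plus X x -> rp_plus X (U t x);
  rp_unitary_group_theta : forall t x,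
    rp_theta X (U t (rp_theta X x)) = U (- t) x
}.

Record realizes (H : hilbertType R) (C : R -> {linear H -> H})
    (X : rp_space) (U : R -> {linear X -> X}) (Q : os_quotient X)
    (Uhat : R -> {linear Q -> Q}) (G : {linear Q -> H}) : Prop := {
  realizes_group : rp_unitary_group U;
  realizes_semigroup : contraction_semigroup Uhat;
  realizes_induced : forall t x, 0 <= t -> rp_plus X x ->
    Uhat t (os_q Q x) = os_q Q (U t x);
  realizes_unitary : unitary G;
  realizes_intertwines : forall t x, 0 <= t -> G (Uhat t x) = C t (G x)
}.

Definition euclidean_realization (H : hilbertType R) (C : R -> {linear H -> H})
    (X : rp_space) (U : R -> {linear X -> X}) : Prop :=
  exists (Q : os_quotient X) (Uhat : R -> {linear Q -> Q})
    (G : {linear Q -> H}), realizes C U Uhat G.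

Definition zero_cyclic (X : rp_space) (U : R -> {linear X -> X}) : Prop :=
  closure (lspan (\bigcup_t (U t @` rp_zero X))) = setT.

Definition plus_generated (X : rp_space) (U : R -> {linear X -> X}) : Prop :=
  rp_plus X =
    closure (lspan (\bigcup_(t in [set t | 0 < t]) (U t @` rp_zero X))).

(* A Hilbert space F of H-valued functions on T: an element f stands for the
   function s |-> rkhs_ev s f, and rkhs_ext says that it is determined by it. *)
Record rkhs (T : Type) (H : hilbertType R) (K : T -> T -> H -> H) := Rkhs {
  rkhs_sort :> hilbertType R;
  rkhs_ev : T -> {linear rkhs_sort -> H};
  rkhs_ev_adj : T -> {linear H -> rkhs_sort};
  rkhs_ext : forall f g, (forall s, rkhs_ev s f = rkhs_ev s g) -> f = g;
  rkhs_ev_continuous : forall s, continuous (rkhs_ev s);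
  rkhs_ev_adjoint : forall s, adjoint (rkhs_ev s) (rkhs_ev_adj s);
  rkhs_kernel : forall s t v, rkhs_ev s (rkhs_ev_adj t v) = K s t v
}.

Arguments rkhs_ev {T H K} F s : rename.
Arguments rkhs_ev_adj {T H K} F s : rename.

Record minimal_dilation (H : hilbertType R) (C : R -> {linear H -> H}) :=
  MinimalDilation {
  dil_rkhs :> rkhs (fun s t : R => C `|s - t| : H -> H);
  dil_U : R -> {linear dil_rkhs -> dil_rkhs};
  dil_theta : {linear dil_rkhs -> dil_rkhs};
  dil_UE : forall t f s,
    rkhs_ev dil_rkhs s (dil_U t f) = rkhs_ev dil_rkhs (s + t) f;
  dil_thetaE : forall f s,
    rkhs_ev dil_rkhs s (dil_theta f) = rkhs_ev dil_rkhs (- s) f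
}.

Arguments dil_U {H C} D t : rename.
Arguments dil_theta {H C} D : rename.

Definition dil_emb (H : hilbertType R) (C : R -> {linear H -> H})
    (D : minimal_dilation C) : {linear H -> D} := rkhs_ev_adj D 0.

Definition dil_zero (H : hilbertType R) (C : R -> {linear H -> H})
    (D : minimal_dilation C) : set D := range (dil_emb D).

Arguments dil_zero {H C} D _.

Definition dil_plus (H : hilbertType R) (C : R -> {linear H -> H})
    (D : minimal_dilation C) : set D :=
  closure (lspan (\bigcup_(t in [set t | 0 < t]) (dil_U D t @` dil_zero D))).

Arguments dil_plus {H C} D _.

(* V carries all the structure of the realization to that of the dilation,
   including the two identifications of H with a subspace: through os_q and
   G on the left, through dil_emb on the right. *)
Record dilation_equivalence (H : hilbertType R) (C : R -> {linear H -> H})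
    (X : rp_space) (U : R -> {linear X -> X}) (Q : os_quotient X)
    (G : {linear Q -> H}) (D : minimal_dilation C) (V : {linear X -> D}) :
    Prop := {
  dilation_equivalence_unitary : unitary V;
  dilation_equivalence_U : forall t x, V (U t x) = dil_U D t (V x);
  dilation_equivalence_theta : forall x, V (rp_theta X x) = dil_theta D (V x);
  dilation_equivalence_plus : V @` rp_plus X = dil_plus D;
  dilation_equivalence_zero : V @` rp_zero X = dil_zero D;
  dilation_equivalence_emb : forall x, rp_zero X x ->
    V x = dil_emb D (G (os_q Q x))
}.

End HilbertSpaces.

(* Main.v *)
(* The kernel [C `|s - t|] is positive definite without any spectral theory: in
   a finite sum the leftmost mass can be pushed to the next time, which keeps the
   cross terms by the semigroup law and decreases the diagonal term since [C] is
   contractive.  The reproducing kernel space consists of the functions that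
   kernel sections approximate, as functionals on formal kernel combinations.
   On the closed span of the [ev_(-t)^* v] with [t > 0] one has
   [<f, theta g> = <f 0, g 0>], so evaluation at [0] is the quotient map, and
   [ev_0^* H] is the fixed space of [theta]; this gives the realization.
   Conversely the Markov property makes the quotient map isometric from [E0] onto
   the quotient.  If [j : H -> E0] denotes the inverse identification, the vectors
   [U_t (j v)] have Gram matrix [<C `|t - s| v, w>], the one of the
   [ev_(-t)^* v], and both families are total. *)

Require Import Defs.
From HB Require Import structures.
From mathcomp Require Import all_boot all_order all_algebra.
From mathcomp Require Import complex ring.
From mathcomp Require Import all_classical all_reals all_analysis.

Set Implicit Arguments.
Unset Strict Implicit.
Unset Printing Implicit Defensive.

Import Order.TTheory GRing.Theory Num.Theory.
Import numFieldNormedType.Exports.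

Local Open Scope classical_set_scope.
Local Open Scope ring_scope.

(** * Scalar inequalities and inner products *)

(** The kernel space is built inside [T -> H], with no quotient and no abstract completion. The norm
    of [f] is a dual norm, the least [c] with [|pairing f y| <= c * knorm y] for all [y], so vectors
    are functions from the start and completeness reduces to pointwise limits in [H]. The price is
    that the inner product comes afterwards, as a limit of pairings with approximants of its second
    argument, and its symmetry has to be proved. Signs: [(U_t f)(s) = f(s + t)] moves the kernel
    section at [s] to [s - t], so positive times produce sections at negative points. The identity
    for [theta] rests on [f t = C t (f 0)] for [t >= 0] and [f] in the positive space, which is the
    semigroup law read on generators. As that space is generated by strictly positive times, it is
    strong continuity that puts [ev_0^* H] inside it. In the converse the Markov property enters
    through one fact, that the quotient map sends [E0] onto the quotient. *)

Section Scalars.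
Variable K : numClosedFieldType.
Implicit Types a b c l : K.

(** The scalar core of Cauchy-Schwarz: the quadratic is the squared length of [x - l y], and
    [l = c / b] minimises it. If [b = 0] and [c] is nonzero, the multiple [k * c] is scaled so that
    the value is [- (a + 2)]. Semidefiniteness suffices, so it also serves kernel pairings before a
    norm exists. *)
Lemma sqr_norm_le_of_quadratic a b c : 0 <= a -> 0 <= b ->
  (forall l, 0 <= a - l^* * c - l * c^* + l * l^* * b) -> `|c| ^+ 2 <= a * b.
Proof.
move=> a0 b0 H; rewrite normCK.
have [bE|bN0] := eqVneq b 0.
  rewrite {b b0}bE in H *; rewrite mulr0; have [->|cN0] := eqVneq c 0; first by rewrite mul0r.
  have cc0 : 0 < c * c^* by rewrite -normCK exprn_gt0 ?normr_gt0.
  pose k := (a + 1) / (c * c^*).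
  have kr : k^* = k.
    apply: CrealP; rewrite rpredM ?rpredV ?rpredD ?ger0_real //.
    exact: ltW.
  have := H (k * c); rewrite rmorphM /= kr !mulr0 addr0.
  have -> : k * c^* * c = a + 1.
    by rewrite -mulrA (mulrC c^*) /k divfK // gt_eqF.
  have -> : k * c * c^* = a + 1 by rewrite -mulrA /k divfK // gt_eqF.
  have -> : a - (a + 1) - (a + 1) = - (a + 2) by ring.
  rewrite oppr_ge0 => a2.
  by move: (lt_le_trans (ltr_wpDl a0 (ltr0n K 2)) a2); rewrite ltxx.
have bp : 0 < b by rewrite lt_def bN0.
have := H (c / b).
have br : b^-1^* = b^-1 by apply: CrealP; rewrite rpredV ger0_real.
rewrite rmorphM /= br.
have -> : a - c^* / b * c - c / b * c^* + c / b * (c^* / b) * b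
   = (a * b - c * c^*) / b by field.
by rewrite pmulr_lge0 ?invr_gt0 // subr_ge0.
Qed.

(** The two hypotheses compare real and imaginary parts; they are what the square norms of [x + y]
    and [x + 'i *: y] deliver. *)
Lemma eq_of_polarization a b : a + a^* = b + b^* ->
  'i * a - 'i * a^* = 'i * b - 'i * b^* -> a = b.
Proof.
move=> h1 h2.
have {}h2 : a - a^* = b - b^*.
  by apply: (mulfI (neq0Ci K)); rewrite !mulrBr.
have h : 2 * a = 2 * b.
  have -> : 2 * a = (a + a^*) + (a - a^*) by ring.
  by rewrite h1 h2; ring.
by apply: (mulfI _ h); rewrite pnatr_eq0.
Qed.

Lemma norm_le_gt0_eq0 (V : normedZmodType K) (x : V) (M : K) :
  0 <= M -> (forall e, 0 < e -> `|x| <= M * e) -> x = 0.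
Proof.
move=> M0 H; apply/eqP; rewrite -normr_le0; apply/negP => nx.
have xp : 0 < `|x|.
  by rewrite normr_gt0; apply/negP => /eqP x0; apply: nx; rewrite x0 normr0.
have M1 : 0 < M + 1 by rewrite ltr_wpDl.
have := H (`|x| / (M + 1)); rewrite divr_gt0 // => /(_ isT).
rewrite mulrA ler_pdivlMr // mulrDr mulr1 mulrC gerDl => h.
exact: nx.
Qed.

(** The order on the complex scalars is partial, hence the realness conditions. Having [e <= 1]
    available lets error terms that are quadratic in [e] be bounded linearly. *)
Lemma le_of_le_add_gt0 a b (M : K) : a \is Num.real -> b \is Num.real ->
  0 <= M -> (forall e, 0 < e -> e <= 1 -> a <= b + M * e) -> a <= b.
Proof.
move=> ar br M0 H; case: (real_leP ar br) => // ba.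
have M1 : 0 < M + 1 by rewrite ltr_wpDl.
have ab : 0 < a - b by rewrite subr_gt0.
pose d := (a - b) / (M + 1).
have d0 : 0 < d by rewrite divr_gt0.
have dr : d \is Num.real by rewrite gtr0_real.
pose e := if d <= 1 then d else 1.
have ed : e <= d.
  rewrite /e; case: ifP => // h; case: (real_leP dr (real1 K)) h => //.
  by move=> /ltW.
have e0 : 0 < e by rewrite /e; case: ifP.
have e1 : e <= 1 by rewrite /e; case: ifP.
have h := H e e0 e1.
have : a <= b + M * d by apply: le_trans h _; rewrite lerD2l ler_wpM2l.
rewrite -lerBlDl => h2.
have : (M + 1) * d <= M * d by rewrite /d mulrC divfK ?gt_eqF.
by rewrite mulrDl mul1r gerDl => /(lt_le_trans d0); rewrite ltxx.
Qed.

Lemma ge0_of_approx a (M : K) : a \is Num.real -> 0 <= M ->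
  (forall e, 0 < e -> e <= 1 -> exists2 p, 0 <= p & `|a - p| <= M * e) ->
  0 <= a.
Proof.
move=> ar M0 H; apply: (@le_of_le_add_gt0 0 a M) => // e e0 e1.
have [p p0 hp] := H e e0 e1.
have pr : p \is Num.real by rewrite ger0_real.
apply: le_trans p0 _; rewrite -lerBlDl.
by apply: le_trans hp; rewrite distrC; apply: real_ler_norm; rewrite rpredB.
Qed.

End Scalars.

Section Inner.
Variable R : realType.
Variable E : hilbertType R.
Implicit Types (x y z : E) (a b c : R[i]).

Lemma hdotDl x y z : '[< x + y, z >] = '[< x, z >] + '[< y, z >].
Proof. exact: linearDl. Qed.
Lemma hdotDr x y z : '[< x, y + z >] = '[< x, y >] + '[< x, z >].
Proof. exact: linearDr. Qed.
Lemma hdotBl x y z : '[< x - y, z >] = '[< x, z >] - '[< y, z >].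
Proof. exact: linearBl. Qed.
Lemma hdotBr x y z : '[< x, y - z >] = '[< x, y >] - '[< x, z >].
Proof. exact: linearBr. Qed.
Lemma hdot0l x : '[< 0, x >] = 0.
Proof. exact: linear0l. Qed.
Lemma hdotZl a x y : '[< a *: x, y >] = a * '[< x, y >].
Proof. by rewrite linearZl_LR. Qed.
Lemma hdotZr a x y : '[< x, a *: y >] = a^* * '[< x, y >].
Proof. by rewrite linearZr_LR. Qed.
Lemma hdot_suml I (r : seq I) (F : I -> E) y :
  '[< \sum_(i <- r) F i, y >] = \sum_(i <- r) '[< F i, y >].
Proof. exact: linear_sumlz. Qed.
Lemma hdot_sumr I (r : seq I) (F : I -> E) y :
  '[< y, \sum_(i <- r) F i >] = \sum_(i <- r) '[< y, F i >].
Proof. exact: linear_sumr. Qed.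
Lemma hdotC x y : '[< x, y >] = '[< y, x >]^*.
Proof. by rewrite hermitian_subproof expr0 mul1r. Qed.

Lemma hdot_ge0 x : 0 <= '[< x, x >].
Proof. by rewrite -hdotE exprn_ge0. Qed.

Lemma hdot_eq0 x : '[< x, x >] = 0 -> x = 0.
Proof. by rewrite -hdotE => /eqP; rewrite expf_eq0 /= normr_eq0 => /eqP. Qed.

Lemma hdot_eqP x y : (forall z, '[< x, z >] = '[< y, z >]) -> x = y.
Proof.
move=> h; apply/eqP; rewrite -subr_eq0; apply/eqP/hdot_eq0.
by rewrite hdotBl h subrr.
Qed.

Lemma norm_sqrtC x : `|x| = sqrtC '[< x, x >].
Proof. by rewrite -hdotE sqrCK. Qed.

Lemma hdot_sub_scale x y a : '[< x - a *: y, x - a *: y >] =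
  '[< x, x >] - a^* * '[< x, y >] - a * '[< x, y >]^* + a * a^* * '[< y, y >].
Proof. by rewrite hdotBl !hdotBr !hdotZl !hdotZr -(hdotC y x); ring. Qed.

Lemma cauchy_schwarz x y : `|'[< x, y >]| <= `|x| * `|y|.
Proof.
rewrite -(@ler_pXn2r _ 2) ?nnegrE ?mulr_ge0 // exprMn !hdotE.
apply: sqr_norm_le_of_quadratic; rewrite ?hdot_ge0 // => l.
by rewrite -hdot_sub_scale hdot_ge0.
Qed.

Lemma parallelogram x y :
  `|x + y| ^+ 2 + `|x - y| ^+ 2 = 2 * (`|x| ^+ 2 + `|y| ^+ 2).
Proof. by rewrite !hdotE !hdotBl !hdotDl !hdotBr !hdotDr; ring. Qed.

Lemma norm_sub_sqr x y :
  `|x - y| ^+ 2 = '[< x, x >] + '[< y, y >] - ('[< x, y >] + '[< x, y >]^*).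
Proof. by rewrite !hdotE !hdotBl !hdotBr -(hdotC y x); ring. Qed.

Lemma hdot_continuousl z : continuous (fun x : E => '[< x, z >] : R[i]^o).
Proof.
move=> x; apply/cvgrPdist_le => /= e e0.
have z0 : 0 < `|z| + 1 by rewrite ltr_wpDl.
near=> y.
rewrite -hdotBl; apply: le_trans (cauchy_schwarz _ _) _.
have h : `|x - y| <= e / (`|z| + 1).
  near: y; move: (@cvg_id _ (nbhs x)) => /cvgrPdist_le; apply.
  by rewrite divr_gt0.
apply: le_trans (_ : e / (`|z| + 1) * (`|z| + 1) <= e).
  by apply: ler_pM => //; rewrite lerDl.
by rewrite divfK ?gt_eqF.
Unshelve. all: by end_near. Qed.

Lemma closed_hdotl z c : closed [set x : E | '[< x, z >] = c].
Proof.
pose h := closed_comp (f := fun x : E => '[< x, z >] : R[i]^o) (D := [set c]).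
apply: h; first by move=> x _; exact: hdot_continuousl.
by apply: accessible_closed_set1; apply: hausdorff_accessible; exact: norm_hausdorff.
Qed.

End Inner.

(** * Closures and closed linear spans *)

Section Spans.
Variable R : realType.
Variable E : hilbertType R.
Implicit Types (x y z : E) (A M : set E).

Lemma closure_normP A x :
  closure A x <-> forall e, 0 < e -> exists2 y, A y & `|x - y| <= e.
Proof.
split=> [cA e e0|h B /nbhs_ballP[e /= e0 eB]].
  have /cA[y [Ay xy]] : nbhs x (ball x e) by exact: nbhsx_ballx.
  by exists y => //; rewrite ltW //; move: xy; rewrite -ball_normE.
have [|y Ay xy] := h (e / 2); first by rewrite divr_gt0.
exists y; split=> //; apply: eB; rewrite -ball_normE /=.
by apply: le_lt_trans xy _; rewrite ltr_pdivrMr // ltr_pMr // ltr1n.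
Qed.

Lemma submod_closedP A : submod_closed [in A] <->
  A 0 /\ forall (a : R[i]) x y, A x -> A y -> A (a *: x + y).
Proof.
split=> -[A0 Al]; split.
- by move: A0; rewrite inE.
- by move=> a x y Ax Ay; move: (Al a x y); rewrite !inE; apply.
- by rewrite inE.
- by move=> a x y; rewrite !inE; apply: Al.
Qed.

Lemma submodD A x y : submod_closed [in A] -> A x -> A y -> A (x + y).
Proof. by case/submod_closedP => _ h Ax Ay; rewrite -(scale1r x); apply: h. Qed.

Lemma submodZ A a x : submod_closed [in A] -> A x -> A (a *: x).
Proof. by case/submod_closedP => h0 h Ax; rewrite -(addr0 (_ *: _)); apply: h. Qed.

Lemma submodB A x y : submod_closed [in A] -> A x -> A y -> A (x - y).
Proof.
move=> hA Ax Ay; apply: submodD => //.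
by rewrite -scaleN1r; apply: submodZ.
Qed.

Lemma sub_lspan A : A `<=` lspan A.
Proof. exact: sub_smallest. Qed.

Lemma lspan_submod A : submod_closed [in lspan A].
Proof.
apply/submod_closedP; split=> [B [/submod_closedP[]]//|a x y lx ly B [hB AB]].
by have /submod_closedP[_] := hB; apply; [apply: lx|apply: ly].
Qed.

Lemma lspan_min A M : submod_closed [in M] -> A `<=` M -> lspan A `<=` M.
Proof. by move=> ? ? ; apply: smallest_sub. Qed.

Lemma closure_submod A : submod_closed [in A] -> submod_closed [in closure A].
Proof.
move=> /submod_closedP[A0 Al]; apply/submod_closedP; split.
  exact: subset_closure.
move=> a x y /closure_normP cx /closure_normP cy; apply/closure_normP => e e0.
have a1 : 0 < `|a| + 1 by rewrite ltr_wpDl.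
have [|x' Ax' xx'] := cx (e / 2 / (`|a| + 1)); first by rewrite !divr_gt0.
have [|y' Ay' yy'] := cy (e / 2); first by rewrite divr_gt0.
exists (a *: x' + y'); first exact: Al.
rewrite opprD addrACA -scalerBr; apply: le_trans (ler_normD _ _) _.
rewrite [leRHS](splitr e); apply: lerD => //.
rewrite normrZ; apply: (@le_trans _ _ ((`|a| + 1) * (e / 2 / (`|a| + 1)))).
  by apply: ler_pM => //; rewrite lerDl.
by rewrite mulrC divfK ?gt_eqF.
Qed.

Lemma clspan_submod A : submod_closed [in closure (lspan A)].
Proof. by apply/closure_submod/lspan_submod. Qed.

Lemma sub_clspan A : A `<=` closure (lspan A).
Proof. by apply: subset_trans (@subset_closure _ _); exact: sub_lspan. Qed.

Lemma clspan_min A M : submod_closed [in M] -> closed M -> A `<=` M ->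
  closure (lspan A) `<=` M.
Proof.
move=> hM cM AM; rewrite (closure_id M).1 //; apply: closure_subset.
exact: lspan_min.
Qed.

Lemma submod_orthogonal z : submod_closed [in [set x : E | '[< x, z >] = 0]].
Proof.
apply/submod_closedP; split=> [|a x y /= hx hy]; first exact: hdot0l.
by rewrite hdotDl hdotZl hx hy mulr0 addr0.
Qed.

Lemma clspan_orthogonal A z : (forall x, A x -> '[< x, z >] = 0) ->
  forall x, closure (lspan A) x -> '[< x, z >] = 0.
Proof.
move=> h; apply: clspan_min => //; first exact: submod_orthogonal.
exact: closed_hdotl.
Qed.

End Spans.

(** * Completeness and orthogonal projections *)

Section Completeness.

Lemma complete_seq (K : numFieldType) (V : completeNormedModType K)
    (u : nat -> V) :
  (forall e, 0 < e -> exists N, forall m n, (N <= m)%N -> (N <= n)%N ->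
    `|u m - u n| <= e) ->
  exists l, forall e, 0 < e -> exists N, forall n, (N <= n)%N -> `|l - u n| <= e.
Proof.
move=> uC.
have : cauchy (u @ \oo).
  apply/cauchyP => e e0.
  have [|N hN] := uC (e / 2); first by rewrite divr_gt0.
  exists (u N); exists N => // n /= Nn; rewrite -ball_normE /=.
  apply: le_lt_trans (hN _ _ (leqnn N) Nn) _.
  by rewrite ltr_pdivrMr // ltr_pMr // ltr1n.
move=> /cauchy_cvgP /cvg_ex[l /cvgrPdist_le ul].
by exists l => e /ul[N _ hN]; exists N.
Qed.

Variable R : realType.
Implicit Types e : R[i].

(** Real and imaginary parts are Cauchy because both are bounded by the modulus. The limit supplies
    the values of the inner product of the kernel space. *)
Lemma complex_seq_complete (u : nat -> R[i]) :
  (forall e, 0 < e -> exists N, forall m n, (N <= m)%N -> (N <= n)%N ->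
    `|u m - u n| <= e) ->
  exists l, forall e, 0 < e -> exists N, forall n, (N <= n)%N -> `|l - u n| <= e.
Proof.
move=> uC.
have normRe (z : R[i]) : `|complex.Re z| <= complex.Re `|z|.
  by have := normc_ge_Re z; rewrite lecE => /andP[].
have normIm (z : R[i]) : `|complex.Im z| <= complex.Re `|z|.
  by have := normRe (z * 'i%C); rewrite ReiNIm normrN normrM
    complexiE normCi mulr1.
have [|p hp] := @complete_seq R R (fun n => complex.Re (u n)).
  move=> e e0; have [|N hN] := uC e%:C%C; first by rewrite ltcR.
  exists N => m n mN nN; rewrite -raddfB; apply: le_trans (normRe _) _.
  by have := hN m n mN nN; rewrite lecE => /andP[].
have [|q hq] := @complete_seq R R (fun n => complex.Im (u n)).
  move=> e e0; have [|N hN] := uC e%:C%C; first by rewrite ltcR.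
  exists N => m n mN nN; rewrite -raddfB; apply: le_trans (normIm _) _.
  by have := hN m n mN nN; rewrite lecE => /andP[].
exists (p +i* q)%C => e e0.
have eE : e = (complex.Re e)%:C%C by rewrite RRe_real // gtr0_real.
have re0 : 0 < complex.Re e / 2 by rewrite divr_gt0 //; move: e0; rewrite {1}eE ltcR.
have [N1 h1] := hp _ re0; have [N2 h2] := hq _ re0.
exists (maxn N1 N2) => n; rewrite geq_max => /andP[n1 n2].
have -> : (p +i* q)%C - u n = (p - complex.Re (u n))%:C%C +
    'i%C * (q - complex.Im (u n))%:C%C.
  by case: (u n) => a b /=; apply/eqP; rewrite eq_complex /=; apply/andP; split;
    apply/eqP; ring.
apply: le_trans (ler_normD _ _) _.
rewrite normrM complexiE normCi mul1r.
have nC (r : R) : `|r%:C%C| = `|r|%:C%C.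
  by rewrite normc_def /= expr0n /= addr0 sqrtr_sqr.
rewrite !nC eE -raddfD lecR [leRHS](splitr (complex.Re e)).
by apply: lerD; [exact: h1|exact: h2].
Qed.

Lemma complex_archi e : 0 < e ->
  exists N, forall n, (N <= n)%N -> n.+1%:R^-1 <= e.
Proof.
move=> e0.
have eE : e = (complex.Re e)%:C%C by rewrite RRe_real // gtr0_real.
have re0 : 0 < complex.Re e by move: e0; rewrite {1}eE ltcR.
have [N _ hN] := near_infty_natSinv_lt (PosNum re0).
exists N => n Nn; have := hN n Nn; rewrite /= => /ltW h.
have -> : n.+1%:R^-1 = (n.+1%:R^-1 : R)%:C%C :> R[i] by rewrite fmorphV rmorph_nat.
by rewrite eE lecR.
Qed.

(** Nonnegative complex numbers are real, so the infimum is taken among real parts. *)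
Lemma complex_inf (A : set R[i]) : A !=set0 -> (forall a, A a -> 0 <= a) ->
  exists2 d, d \is Num.real /\ (forall a, A a -> d <= a) &
  forall e, 0 < e -> exists2 a, A a & a <= d + e.
Proof.
move=> [a0 Aa0] A_ge0.
have AE a : A a -> a = (complex.Re a)%:C%C.
  by move=> /A_ge0 ?; rewrite RRe_real // ger0_real.
pose S := [set complex.Re a | a in A].
have Sinf : has_inf S.
  split; first by exists (complex.Re a0); exists a0.
  by exists 0 => _ [a Aa <-]; have := A_ge0 a Aa; rewrite lecE => /andP[].
exists (inf S)%:C%C => [|e e0].
  split; first by apply/complex_realP; exists (inf S).
  move=> a Aa; rewrite (AE a Aa) lecR.
  by apply: ge_inf; [case: Sinf|exists a].
have eE : e = (complex.Re e)%:C%C by rewrite RRe_real // gtr0_real.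
have re0 : 0 < complex.Re e by move: e0; rewrite {1}eE ltcR.
have [_ [a Aa <-] ha] := inf_adherent re0 Sinf.
by exists a => //; rewrite (AE a Aa) eE -raddfD lecR ltW.
Qed.

End Completeness.

Lemma bounded_continuous (R : realType) (E F : hilbertType R)
    (f : {linear E -> F}) (b : R[i]) :
  0 <= b -> (forall x, `|f x| <= b * `|x|) -> continuous f.
Proof.
move=> b0 hb x; have b1 : 0 < b + 1 by rewrite ltr_wpDl.
apply/cvgrPdist_le => /= e e0; near=> y.
rewrite -raddfB; apply: le_trans (hb _) _.
apply: (@le_trans _ _ ((b + 1) * `|x - y|)).
  by rewrite ler_wpM2r // lerDl.
rewrite mulrC -ler_pdivlMr //.
near: y; move: (@cvg_id _ (nbhs x)) => /cvgrPdist_le; apply.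
by rewrite divr_gt0.
Unshelve. all: by end_near. Qed.

Section Projection.
Variable R : realType.
Variable E : hilbertType R.
Implicit Types (x y z : E) (A M : set E).

(** A minimising sequence for the distance is Cauchy by the parallelogram identity, since midpoints
    stay in [M]. Orthogonality is first obtained approximately, for the sequence, and then passed to
    the limit. *)
Theorem projection_exists M : submod_closed [in M] -> closed M ->
  forall x, exists y, M y /\ forall z, M z -> '[< x - y, z >] = 0.
Proof.
move=> hM cM x.
have M0 : M 0 by have /submod_closedP[] := hM.
have [||d [dr dle] dinf] := @complex_inf R [set `|x - m| ^+ 2 | m in M].
- by exists (`|x - 0| ^+ 2); exists 0.
- by move=> _ [m _ <-]; rewrite exprn_ge0.
have dM m : M m -> d <= `|x - m| ^+ 2 by move=> Mm; apply: dle; exists m.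
have /choice[u hu] n : exists y, M y /\ `|x - y| ^+ 2 <= d + n.+1%:R^-1.
  have [|_ [m Mm <-] hm] := dinf n.+1%:R^-1; first by rewrite invr_gt0 ltr0n.
  by exists m.
have Mu n : M (u n) by case: (hu n).
have du n : `|x - u n| ^+ 2 - d <= n.+1%:R^-1.
  by rewrite lerBlDl; case: (hu n).
(* The parallelogram identity counts each of the two excesses over [d] twice, so an excess of
   [e ^+ 2 / 4] gives distance at most [e]. *)
have sqe e : 0 < e -> 0 < e ^+ 2 / 4 :> R[i].
  by move=> e0; rewrite divr_gt0 // exprn_gt0.
have [|l hl] := @complete_seq _ E u.
  move=> e e0; have [N hN] := complex_archi (sqe e e0).
  exists N => m n mN nN.
  rewrite -(@ler_pXn2r _ 2) ?nnegrE ?(ltW e0) //.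
  have p := parallelogram (x - u m) (x - u n).
  have q : d <= `|x - 2^-1 *: (u m + u n)| ^+ 2.
    by apply: dM; apply: submodZ => //; apply: submodD.
  have e1 : x - u m - (x - u n) = - (u m - u n) by rewrite opprB addrC addrA subrK opprB.
  have e2 : x - u m + (x - u n) = 2 *: (x - 2^-1 *: (u m + u n)).
    rewrite scalerBr scalerA divff ?pnatr_eq0 // scale1r scaler_nat mulr2n.
    by rewrite opprD addrACA.
  rewrite e1 e2 normrN normrZ exprMn ger0_norm // in p.
  have -> : `|u m - u n| ^+ 2 = 2 * (`|x - u m| ^+ 2 - d) + 2 * (`|x - u n| ^+ 2 - d)
      - 4 * (`|x - 2^-1 *: (u m + u n)| ^+ 2 - d).
    have -> : `|u m - u n| ^+ 2 = 2 ^+ 2 * `|x - 2^-1 *: (u m + u n)| ^+ 2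
      + `|u m - u n| ^+ 2 - 2 ^+ 2 * `|x - 2^-1 *: (u m + u n)| ^+ 2 by ring.
    by rewrite p; ring.
  have am := le_trans (du m) (hN m mN).
  have an := le_trans (du n) (hN n nN).
  apply: (@le_trans _ _ (2 * (e ^+ 2 / 4) + 2 * (e ^+ 2 / 4) - 4 * 0)); last first.
    by rewrite [leLHS](_ : _ = e ^+ 2) //; field.
  apply: lerB; first by apply: lerD; rewrite ler_wpM2l.
  by rewrite ler_wpM2l // subr_ge0.
exists l; split.
  rewrite (closure_id M).1 //; apply/closure_normP => e /hl[N hN].
  by exists (u N) => //; apply: hN.
move=> z Mz; apply: (@norm_le_gt0_eq0 _ R[i]^o _ (`|z| + `|z|)).
  by rewrite addr_ge0.
move=> e e0; have [N1 h1] := hl e e0.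
have e20 : 0 < e ^+ 2 by rewrite exprn_gt0.
have [N2 h2] := complex_archi e20.
pose n := maxn N1 N2.
have {}h1 := h1 n (leq_maxl _ _); have {}h2 := h2 n (leq_maxr _ _).
(* Every [u n + c *: z] lies in [M], so the quadratic in [c] stays nonnegative even after
   subtracting [d]: Cauchy-Schwarz with the excess over the infimum in place of the square norm. *)
have cs : `|'[< x - u n, z >]| ^+ 2 <= (`|x - u n| ^+ 2 - d) * '[< z, z >].
  apply: sqr_norm_le_of_quadratic; first by rewrite subr_ge0; apply: dM.
    exact: hdot_ge0.
  move=> c; have := dM (u n + c *: z).
  rewrite opprD addrA hdotE hdot_sub_scale -hdotE -subr_ge0 => h.
  have -> : `|x - u n| ^+ 2 - d - c^* * '[< x - u n, z >] -
    c * ('[< x - u n, z >])^* + c * c^* * '[< z, z >] =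
    `|x - u n| ^+ 2 - c^* * '[< x - u n, z >] -
    c * ('[< x - u n, z >])^* + c * c^* * '[< z, z >] - d by ring.
  by apply: h; apply: submodD => //; apply: submodZ.
have -> : '[< x - l, z >] = '[< x - u n, z >] - '[< l - u n, z >].
  by rewrite -hdotBl opprB addrA subrK.
apply: le_trans (ler_normB _ _) _; rewrite mulrDl; apply: lerD.
  rewrite -(@ler_pXn2r _ 2) ?nnegrE ?mulr_ge0 ?(ltW e0) //.
  apply: le_trans cs _; rewrite exprMn mulrC -hdotE ler_wpM2l ?exprn_ge0 //.
  by apply: le_trans (du n) _.
apply: le_trans (cauchy_schwarz _ _) _.
by rewrite mulrC ler_wpM2l.
Qed.

Lemma clspan_total A :
  (forall z, (forall x, A x -> '[< x, z >] = 0) -> z = 0) ->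
  closure (lspan A) = setT.
Proof.
move=> h; apply/seteqP; split => // x _.
have [y [My hy]] := projection_exists (clspan_submod A) (@closed_closure _ _) x.
suff /eqP : x - y = 0 by rewrite subr_eq0 => /eqP ->.
apply: h => z Az; rewrite hdotC hy ?conjC0 //.
exact: sub_clspan.
Qed.

Lemma orthoprojP M x : submod_closed [in M] -> closed M ->
  M (orthoproj M x) /\ forall z, M z -> '[< x - orthoproj M x, z >] = 0.
Proof.
move=> hM cM; rewrite /orthoproj; case: xgetP => [y -> []//|h].
by have [y hy] := projection_exists hM cM x; case: (h y).
Qed.

Lemma orthoproj_eq M x y : submod_closed [in M] -> closed M -> M y ->
  (forall z, M z -> '[< x - y, z >] = 0) -> orthoproj M x = y.
Proof.
move=> hM cM My hy; have [Mp hp] := orthoprojP x hM cM.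
have Md : M (orthoproj M x - y) by apply: submodB.
apply/eqP; rewrite -subr_eq0; apply/eqP/hdot_eq0.
(* The difference of the two candidates is [(x - y) - (x - orthoproj M x)], a difference of vectors
   orthogonal to [M], while itself in [M]. *)
rewrite -{1}[X in X - y](subKr x) -addrA (addrC (- _)) addrA hdotBl.
by rewrite hy // hp // subr0.
Qed.

End Projection.

(** * Extension of isometries *)

Section Isometry.
Variable R : realType.

Lemma isometry_hdot (E F : hilbertType R) (f : {linear E -> F}) :
  (forall x, `|f x| = `|x|) -> forall x y, '[< f x, f y >] = '[< x, y >].
Proof.
move=> h; have hd x : '[< f x, f x >] = '[< x, x >] by rewrite -!hdotE h.
move=> x y; apply: eq_of_polarization.
- have := hd (x + y); rewrite linearD !hdotDl !hdotDr !hd -!addrA => /addrI.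
  by rewrite !addrA => /addIr; rewrite (hdotC (f y)) (hdotC y).
- have := hd (x + 'i *: y).
  rewrite linearD linearZ_LR !hdotDl !hdotDr !hdotZl !hdotZr !hd -!addrA.
  move=> /addrI; rewrite !addrA => /addIr.
  rewrite conjCi !mulNr (hdotC (f y)) (hdotC y) => h2.
  by rewrite -opprB -[RHS]opprB; congr (- _); rewrite addrC h2 addrC.
Qed.

Section Extension.
Variables (I : Type) (E F : hilbertType R) (A : I -> E) (B : I -> F).

Definition comb (V : lmodType R[i]) (f : I -> V) (l : seq (R[i] * I)) : V :=
  \sum_(p <- l) p.1 *: f p.2.

Definition comb_scale (a : R[i]) (l : seq (R[i] * I)) :=
  [seq (a * p.1, p.2) | p <- l].

Lemma comb_cat (V : lmodType R[i]) (f : I -> V) l m :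
  comb f (l ++ m) = comb f l + comb f m.
Proof. exact: big_cat. Qed.

Lemma comb_scaleE (V : lmodType R[i]) (f : I -> V) a l :
  comb f (comb_scale a l) = a *: comb f l.
Proof.
rewrite /comb big_map scaler_sumr; apply: eq_bigr => p _.
by rewrite scalerA.
Qed.

Lemma lspan_range_comb x : lspan (range A) x -> exists l, x = comb A l.
Proof.
pose M : set E := [set x | exists l, x = comb A l].
apply: (lspan_min (M := M)).
  apply/submod_closedP; split; first by exists [::]; rewrite /comb big_nil.
  move=> a _ _ [l ->] [m ->]; exists (comb_scale a l ++ m).
  by rewrite comb_cat comb_scaleE.
by move=> _ [i _ <-]; exists [:: (1, i)]; rewrite /comb big_seq1 scale1r.
Qed.

Hypothesis gram : forall i j, '[< A i, A j >] = '[< B i, B j >].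
Hypothesis totA : closure (lspan (range A)) = setT.

Lemma comb_norm l : `|comb A l| = `|comb B l|.
Proof.
rewrite !norm_sqrtC /comb !hdot_suml; congr sqrtC.
apply: eq_bigr => p _; rewrite !hdot_sumr; apply: eq_bigr => q _.
by rewrite !hdotZl !hdotZr gram.
Qed.

Lemma comb_dist l m : `|comb A l - comb A m| = `|comb B l - comb B m|.
Proof.
by rewrite -!(scaleN1r (comb _ m)) -!comb_scaleE -!comb_cat comb_norm.
Qed.

(* The graph of the extension: the closure in [E * F] of the span of the
   pairs [(A i, B i)]. *)
Definition ext_graph (x : E) (y : F) := forall e : R[i], 0 < e ->
  exists l, `|x - comb A l| <= e /\ `|y - comb B l| <= e.

Lemma ext_graph_norm x y : ext_graph x y -> `|x| = `|y|.
Proof.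
move=> g; apply/eqP; rewrite -subr_eq0; apply/eqP.
apply: (@norm_le_gt0_eq0 R[i] R[i]^o _ 2) => // e /g[l [h1 h2]].
have -> : `|x| - `|y| = (`|x| - `|comb A l|) + (`|comb B l| - `|y|).
  by rewrite comb_norm addrA subrK.
apply: le_trans (ler_normD _ _) _; rewrite mulr_natl mulr2n.
apply: lerD; apply: le_trans (ler_dist_dist _ _) _ => //.
by rewrite distrC.
Qed.

Lemma ext_graph_linear a x y x' y' : ext_graph x y -> ext_graph x' y' ->
  ext_graph (a *: x + x') (a *: y + y').
Proof.
move=> g g' e e0.
have a1 : 0 < `|a| + 1 by rewrite ltr_wpDl.
have [|l [h1 h2]] := g (e / 2 / (`|a| + 1)); first by rewrite !divr_gt0.
have [|l' [h1' h2']] := g' (e / 2); first by rewrite divr_gt0.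
have aux (V : hilbertType R) (u u' v v' : V) :
    `|u - v| <= e / 2 / (`|a| + 1) -> `|u' - v'| <= e / 2 ->
    `|a *: u + u' - (a *: v + v')| <= e.
  move=> hu hv; rewrite opprD addrACA -scalerBr.
  apply: le_trans (ler_normD _ _) _; rewrite [leRHS](splitr e).
  apply: lerD => //; rewrite normrZ.
  apply: (@le_trans _ _ ((`|a| + 1) * (e / 2 / (`|a| + 1)))).
    by apply: ler_pM => //; rewrite lerDl.
  by rewrite mulrC divfK ?gt_eqF.
exists (comb_scale a l ++ l'); rewrite !comb_cat !comb_scaleE.
by split; apply: aux.
Qed.

Lemma ext_graph_gen i : ext_graph (A i) (B i).
Proof.
move=> e e0; exists [:: (1, i)].
by rewrite /comb !big_seq1 !scale1r !subrr !normr0; split; apply: ltW.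
Qed.

(** By linearity [0] is related to [y' - y], and related vectors have equal norms. *)
Lemma ext_graph_uniq x y y' : ext_graph x y -> ext_graph x y' -> y = y'.
Proof.
move=> g g'; apply/eqP; rewrite -subr_eq0 -normr_eq0.
have := ext_graph_linear (-1) g g'; rewrite !scaleN1r addNr.
by move=> /ext_graph_norm; rewrite normr0 addrC -normrN opprB => <-.
Qed.

(** Combinations of the [A i] that approach [x] are Cauchy, and equal Gram matrices make the same
    combinations of the [B i] Cauchy too. *)
Lemma ext_graph_total x : exists y, ext_graph x y.
Proof.
have /closure_normP cx : closure (lspan (range A)) x by rewrite totA.
have /choice[l hl] (n : nat) :
    exists l, `|x - comb A l| <= n.+1%:R^-1.
  have [|y Ay xy] := cx n.+1%:R^-1; first by rewrite invr_gt0 ltr0n.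
  by have [l yE] := lspan_range_comb Ay; exists l; rewrite -yE.
have [|y hy] := @complete_seq _ F (fun n => comb B (l n)).
  move=> e e0.
  have [|N hN] := @complex_archi _ (e / 2); first by rewrite divr_gt0.
  exists N => m n mN nN; rewrite -comb_dist.
  have -> : comb A (l m) - comb A (l n) = (x - comb A (l n)) - (x - comb A (l m)).
    by rewrite opprB [RHS]addrC addrA subrK.
  apply: le_trans (ler_normB _ _) _; rewrite [leRHS](splitr e).
  by apply: lerD; apply: le_trans (hl _) (hN _ _).
exists y => e e0.
have [N1 h1] := hy e e0; have [N2 h2] := complex_archi e0.
exists (l (maxn N1 N2)); split; last by apply: h1; apply: leq_maxl.
by apply: le_trans (hl _) (h2 _ _); apply: leq_maxr.
Qed.

End Extension.

Lemma ext_graph_sym I (E F : hilbertType R) (A : I -> E) (B : I -> F) x y :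
  ext_graph A B x y -> ext_graph B A y x.
Proof. by move=> g e /g[l [? ?]]; exists l. Qed.

(** The graph is symmetric in the two families, so the map built from the exchanged families is the
    inverse. *)
Theorem isometry_extension I (E F : hilbertType R) (A : I -> E) (B : I -> F) :
  (forall i j, '[< A i, A j >] = '[< B i, B j >]) ->
  closure (lspan (range A)) = setT -> closure (lspan (range B)) = setT ->
  exists V : {linear E -> F}, unitary V /\ forall i, V (A i) = B i.
Proof.
move=> gram tA tB.
have gram' i j : '[< B i, B j >] = '[< A i, A j >] by [].
have [f hf] := choice (ext_graph_total gram tA).
have [g hg] := choice (ext_graph_total gram' tB).
have fl : linear f.
  move=> a x y; apply: (ext_graph_uniq gram (hf _)).
  exact: ext_graph_linear.
pose V : {linear E -> F} := HB.pack f (GRing.isLinear.Build _ _ _ _ f fl).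
exists V; split; last by move=> i; apply: (ext_graph_uniq gram (hf _)); exact: ext_graph_gen.
split; first by apply: isometry_hdot => x /=; rewrite -(ext_graph_norm gram (hf x)).
exists g => [x|y].
  exact: (ext_graph_uniq gram' (hg _) (ext_graph_sym (hf x))).
exact: (ext_graph_uniq gram (hf _) (ext_graph_sym (hg y))).
Qed.

End Isometry.

(** * Images and preimages of subspaces under unitary maps *)

Section UnitaryMaps.
Variable R : realType.
Variables E F : hilbertType R.
Variable V : {linear E -> F}.
Hypothesis uV : unitary V.

Lemma unitary_norm x : `|V x| = `|x|.
Proof. by rewrite !norm_sqrtC uV.1. Qed.

Lemma unitary_image_submod (M : set E) :
  submod_closed [in M] -> submod_closed [in V @` M].
Proof.
move=> /submod_closedP[M0 Ml]; apply/submod_closedP; split.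
  by exists 0 => //; rewrite linear0.
by move=> a _ _ [x Mx <-] [y My <-]; exists (a *: x + y); [apply: Ml|rewrite linearP].
Qed.

Lemma preimage_submod (M : set F) :
  submod_closed [in M] -> submod_closed [in V @^-1` M].
Proof.
move=> /submod_closedP[M0 Ml]; apply/submod_closedP; split.
  by rewrite /preimage /= linear0.
by move=> a x y; rewrite /preimage /= linearP; apply: Ml.
Qed.

Lemma unitary_image_clspan (A : set E) :
  V @` closure (lspan A) = closure (lspan (V @` A)).
Proof.
have [W VK WK] := uV.2; apply/seteqP; split.
  move=> _ [x /closure_normP cx <-]; apply/closure_normP => e /cx[y Ay xy].
  exists (V y); last by rewrite -raddfB unitary_norm.
  suff : lspan A `<=` V @^-1` lspan (V @` A) by apply.
  apply: lspan_min; first by apply: preimage_submod; exact: lspan_submod.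
  by move=> a Aa; apply: sub_lspan; exists a.
move=> y /closure_normP cy; exists (W y) => //.
apply/closure_normP => e /cy[z Az yz].
have [a la aE] : (V @` lspan A) z.
  apply: lspan_min Az; first by apply: unitary_image_submod; exact: lspan_submod.
  by move=> _ [a Aa <-]; exists a => //; exact: sub_lspan.
by exists a => //; rewrite -unitary_norm raddfB /= WK aE.
Qed.

End UnitaryMaps.

(** * Reproducing kernel spaces *)

(** The last field bounds evaluation at [s] by [b]; it yields the continuity of evaluations and the
    pointwise limits behind completeness. *)
Record positive_kernel (R : realType) (T : Type) (H : hilbertType R)
    (K : T -> T -> H -> H) : Prop := PositiveKernel {
  kernel_linear : forall s t (a : R[i]) v w,
    K s t (a *: v + w) = a *: K s t v + K s t w;
  kernel_hermitian : forall s t v w, '[< K s t v, w >] = '[< v, K t s w >];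
  kernel_pos : forall x : seq (T * H),
    0 <= \sum_(q <- x) \sum_(p <- x) '[< K q.1 p.1 p.2, q.2 >];
  kernel_bounded : forall s, exists2 b : R[i], 0 <= b &
    forall v, '[< K s s v, v >] <= (b * `|v|) ^+ 2
}.

Section Moore.
Variables (R : realType) (T : Type) (H : hilbertType R) (K : T -> T -> H -> H).
Hypothesis hK : positive_kernel K.
Implicit Types (f g : T -> H) (x y : seq (T * H)) (a c e : R[i]).

(** By the reproducing property this is what the inner product of [f] with the kernel combination
    [kfun y] has to be; it makes sense for any function [f], before an inner product exists. *)
Definition pairing f y : R[i] := \sum_(p <- y) '[< f p.1, p.2 >].

Definition kfun x : T -> H := fun t => \sum_(p <- x) K t p.1 p.2.

Definition kscale a y := [seq (p.1, a *: p.2) | p <- y].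

Lemma pairing_linear a f g y :
  pairing (a *: f + g) y = a * pairing f y + pairing g y.
Proof.
rewrite /pairing mulr_sumr -big_split; apply: eq_bigr => p _ /=.
by rewrite hdotDl hdotZl.
Qed.

Lemma pairingB f g y : pairing (f - g) y = pairing f y - pairing g y.
Proof.
by rewrite addrC -scaleN1r pairing_linear mulN1r addrC.
Qed.

Lemma pairing_cat f x y : pairing f (x ++ y) = pairing f x + pairing f y.
Proof. exact: big_cat. Qed.

Lemma pairing_scale f a y : pairing f (kscale a y) = a^* * pairing f y.
Proof.
rewrite /pairing big_map mulr_sumr; apply: eq_bigr => p _ /=.
by rewrite hdotZr.
Qed.

Lemma kernelD s t v w : K s t (v + w) = K s t v + K s t w.
Proof. by have := kernel_linear hK s t 1 v w; rewrite !scale1r. Qed.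

Lemma kernel0 s t : K s t 0 = 0.
Proof. by have := kernelD s t 0 0; rewrite addr0 => /esym/eqP; rewrite -subr_eq0 addrK => /eqP. Qed.

Lemma kernelZ s t a v : K s t (a *: v) = a *: K s t v.
Proof. by have := kernel_linear hK s t a v 0; rewrite !addr0 kernel0 addr0. Qed.

Lemma kfun_cat x y : kfun (x ++ y) = kfun x + kfun y.
Proof. by apply/funext => t; rewrite /kfun big_cat. Qed.

Lemma kfun_scale a y : kfun (kscale a y) = a *: kfun y.
Proof.
apply/funext => t; rewrite /kfun big_map /=.
rewrite [RHS](_ : _ = a *: \sum_(p <- y) K t p.1 p.2) // scaler_sumr.
by apply: eq_bigr => p _; rewrite kernelZ.
Qed.

Lemma pairing_kfunE x y :
  pairing (kfun x) y = \sum_(q <- y) \sum_(p <- x) '[< K q.1 p.1 p.2, q.2 >].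
Proof. by apply: eq_bigr => q _; rewrite hdot_suml. Qed.

Lemma pairing_kfunC x y : pairing (kfun x) y = (pairing (kfun y) x)^*.
Proof.
rewrite !pairing_kfunE exchange_big /= rmorph_sum; apply: eq_bigr => p _.
rewrite rmorph_sum; apply: eq_bigr => q _.
by rewrite (kernel_hermitian hK); exact: hdotC.
Qed.

Lemma pairing_kfun_ge0 x : 0 <= pairing (kfun x) x.
Proof. by rewrite pairing_kfunE; exact: (kernel_pos hK). Qed.

Definition knorm x := sqrtC (pairing (kfun x) x).

Lemma knorm_ge0 x : 0 <= knorm x.
Proof. by rewrite sqrtC_ge0 pairing_kfun_ge0. Qed.

Lemma knorm_sqr x : knorm x ^+ 2 = pairing (kfun x) x.
Proof. exact: sqrtCK. Qed.

Lemma kfun_cauchy_schwarz x y : `|pairing (kfun x) y| <= knorm x * knorm y.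
Proof.
rewrite -(@ler_pXn2r _ 2) ?nnegrE ?mulr_ge0 ?knorm_ge0 // exprMn !knorm_sqr.
apply: sqr_norm_le_of_quadratic; rewrite ?pairing_kfun_ge0 // => l.
have := pairing_kfun_ge0 (x ++ kscale (- l) y).
rewrite kfun_cat kfun_scale addrC pairing_linear !pairing_cat !pairing_scale.
rewrite -(pairing_kfunC y x) rmorphN /=.
by congr (0 <= _); ring.
Qed.

(** The statement that [f] has norm at most [c], phrased by duality. Formal lists [y] with the same
    [kfun y] never need to be identified. *)
Definition kbound c f := forall y, `|pairing f y| <= c * knorm y.

Lemma kbound_linear c d a f g : kbound c f -> kbound d g ->
  kbound (`|a| * c + d) (a *: f + g).
Proof.
move=> hf hg y; rewrite pairing_linear mulrDl.
apply: le_trans (ler_normD _ _) _; apply: lerD => //.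
by rewrite normrM -mulrA ler_wpM2l.
Qed.

Lemma kboundD c d f g : kbound c f -> kbound d g -> kbound (c + d) (f + g).
Proof.
by move=> hf hg; have := kbound_linear 1 hf hg; rewrite normr1 mul1r scale1r.
Qed.

Lemma kboundN c f : kbound c f -> kbound c (- f).
Proof.
move=> hf y; have -> : pairing (- f) y = - pairing f y.
  by rewrite -[- f]add0r pairingB /pairing big1 ?sub0r // => p _; exact: hdot0l.
by rewrite normrN.
Qed.

Lemma kbound_kfun x : kbound (knorm x) (kfun x).
Proof. by move=> y; exact: kfun_cauchy_schwarz. Qed.

Lemma kbound0 : kbound 0 0.
Proof.
by move=> y; rewrite /pairing big1 ?normr0 ?mul0r // => p _; exact: hdot0l.
Qed.

Lemma kbound_knorm c x : 0 <= c -> kbound c (kfun x) -> knorm x <= c.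
Proof.
move=> c0 /(_ x); rewrite ger0_norm ?pairing_kfun_ge0 // -knorm_sqr expr2.
have := knorm_ge0 x; rewrite le_eqVlt => /predU1P[<-//|k0].
by rewrite ler_pM2r.
Qed.

(** Test the functional on the single section at [t] with vector [f t]: the pairing is the square of
    the norm of [f t], and one factor cancels. *)
Lemma kbound_eval c f t : 0 <= c -> kbound c f ->
  forall b, 0 <= b -> (forall v, '[< K t t v, v >] <= (b * `|v|) ^+ 2) ->
  `|f t| <= c * b.
Proof.
move=> c0 hf b b0 hb; have := hf [:: (t, f t)].
have hN : knorm [:: (t, f t)] <= b * `|f t|.
  rewrite -(@ler_pXn2r _ 2) ?nnegrE ?knorm_ge0 ?mulr_ge0 // knorm_sqr.
  by rewrite pairing_kfunE !big_seq1 /= hb.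
rewrite /pairing big_seq1 /= ger0_norm ?hdot_ge0 // -hdotE expr2 => h.
have [->|fN0] := eqVneq (f t) 0; first by rewrite normr0 mulr_ge0.
rewrite -(@ler_pM2r _ `|f t|) ?normr_gt0 //; apply: le_trans h _.
by rewrite -mulrA ler_wpM2l.
Qed.

Lemma kbound0_eq0 f : kbound 0 f -> f = 0.
Proof.
move=> hf; apply/funext => t; apply/eqP; rewrite -normr_le0.
have [b b0 hb] := kernel_bounded hK t.
by have := kbound_eval (lexx 0) hf b0 hb; rewrite mul0r.
Qed.

Definition in_rkhs f := forall e, 0 < e -> exists x, kbound e (f - kfun x).

Lemma in_rkhs_kfun x : in_rkhs (kfun x).
Proof.
move=> e e0; exists x; rewrite subrr => y.
by apply: le_trans (kbound0 y) _; rewrite mul0r mulr_ge0 ?knorm_ge0 ?ltW.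
Qed.

Lemma in_rkhs0 : in_rkhs 0.
Proof.
have -> : (0 : T -> H) = kfun [::] by apply/funext => t; rewrite /kfun big_nil.
exact: in_rkhs_kfun.
Qed.

Lemma kbound_le c d f : c <= d -> kbound c f -> kbound d f.
Proof.
by move=> cd h y; apply: le_trans (h y) _; rewrite ler_wpM2r ?knorm_ge0.
Qed.

Lemma in_rkhs_linear a f g : in_rkhs f -> in_rkhs g -> in_rkhs (a *: f + g).
Proof.
move=> hf hg e e0; have a1 : 0 < `|a| + 1 by rewrite ltr_wpDl.
have [|x hx] := hf (e / 2 / (`|a| + 1)); first by rewrite !divr_gt0.
have [|y hy] := hg (e / 2); first by rewrite divr_gt0.
exists (kscale a x ++ y); rewrite kfun_cat kfun_scale opprD addrACA -scalerBr.
apply: kbound_le (kbound_linear a hx hy); rewrite [leRHS](splitr e).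
apply: lerD => //; apply: (@le_trans _ _ ((`|a| + 1) * (e / 2 / (`|a| + 1)))).
  by rewrite ler_wpM2r ?lerDl // !divr_ge0 // ltW.
by rewrite mulrC divfK ?gt_eqF.
Qed.

Lemma in_rkhs_kbound f : in_rkhs f -> exists2 c, 0 <= c & kbound c f.
Proof.
move=> /(_ 1 ltr01)[x hx]; exists (1 + knorm x).
  by rewrite addr_ge0 ?knorm_ge0.
by have := kboundD hx (@kbound_kfun x); rewrite subrK.
Qed.

(** Two approximants of the same [g] differ by a formal combination of norm at most [d + d']. This
    makes the pairings with approximants Cauchy, with a limit independent of the choice. *)
Lemma pairing_close c d f y y' g : 0 <= c -> 0 <= d -> kbound c f ->
  kbound d (g - kfun y) -> forall d', 0 <= d' -> kbound d' (g - kfun y') ->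
  `|pairing f y - pairing f y'| <= c * (d + d').
Proof.
move=> c0 d0 hf hy d' d'0 hy'.
have -> : pairing f y - pairing f y' = pairing f (y ++ kscale (-1) y').
  by rewrite pairing_cat pairing_scale rmorphN1 mulN1r.
apply: le_trans (hf _) _; rewrite ler_wpM2l //.
apply: kbound_knorm; first exact: addr_ge0.
rewrite kfun_cat kfun_scale scaleN1r.
have -> : kfun y - kfun y' = - (g - kfun y) + (g - kfun y').
  by rewrite opprB addrA subrK.
by apply: kboundD => //; apply: kboundN.
Qed.

(** The inner product is characterised by its Cauchy-Schwarz error estimate against every
    approximant of [g]; its algebraic properties then follow by choosing approximants. *)
Definition ip_spec f g z := forall c e y, 0 <= c -> 0 <= e -> kbound c f ->
  kbound e (g - kfun y) -> `|z - pairing f y| <= c * e.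

Lemma ip_exists f g : in_rkhs f -> in_rkhs g -> exists z, ip_spec f g z.
Proof.
move=> rf rg; have [c0 c00 hc0] := in_rkhs_kbound rf.
have /choice[u hu] (n : nat) : exists y, kbound n.+1%:R^-1 (g - kfun y).
  by apply: rg; rewrite invr_gt0 ltr0n.
have n0 (n : nat) : 0 <= n.+1%:R^-1 :> R[i] by rewrite invr_ge0 ler0n.
have c1 : 0 < 2 * (c0 + 1) by rewrite mulr_gt0 // ltr_wpDl.
have [|z hz] := @complex_seq_complete R (fun n => pairing f (u n)).
  move=> e e0.
  have [|N hN] := @complex_archi _ (e / (2 * (c0 + 1))); first by rewrite divr_gt0.
  exists N => m n mN nN.
  apply: le_trans (pairing_close c00 (n0 m) hc0 (hu m) (n0 n) (hu n)) _.
  apply: (@le_trans _ _ ((c0 + 1) * (e / (2 * (c0 + 1)) + e / (2 * (c0 + 1))))).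
    apply: ler_pM => //; rewrite ?addr_ge0 ?lerDl //.
    by apply: lerD; apply: hN.
  by rewrite [leLHS](_ : _ = e) //; field; rewrite gt_eqF // ltr_wpDl.
exists z => c e y c_0 e_0 hc he.
apply: (@le_of_le_add_gt0 _ _ _ (1 + c)); rewrite ?ger0_real ?mulr_ge0 ?addr_ge0 //.
move=> d d0 _; have [N1 h1] := hz d d0; have [N2 h2] := complex_archi d0.
pose n := maxn N1 N2.
have -> : z - pairing f y = (z - pairing f (u n)) + (pairing f (u n) - pairing f y).
  by rewrite addrA subrK.
apply: le_trans (ler_normD _ _) _.
have -> : c * e + (1 + c) * d = d + c * (d + e) by ring.
apply: lerD; first by apply: h1; apply: leq_maxl.
apply: le_trans (pairing_close c_0 (n0 n) hc (hu n) e_0 he) _.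
by rewrite ler_wpM2l // lerD2r; apply: h2; apply: leq_maxr.
Qed.

Definition ip f g := xget 0 (ip_spec f g).

Lemma ipP f g : in_rkhs f -> in_rkhs g -> ip_spec f g (ip f g).
Proof.
move=> rf rg; rewrite /ip; case: xgetP => // h.
by have [z hz] := ip_exists rf rg; case: (h z).
Qed.

Lemma ip_kfun f y : in_rkhs f -> ip f (kfun y) = pairing f y.
Proof.
move=> rf; have [c c0 hc] := in_rkhs_kbound rf.
have hy := @in_rkhs_kfun y.
have h0 : kbound 0 (kfun y - kfun y) by rewrite subrr; exact: kbound0.
have := ipP rf hy c0 (lexx 0) hc h0; rewrite mulr0 normr_le0 subr_eq0.
by move/eqP.
Qed.

Lemma ip_linear a f g h : in_rkhs f -> in_rkhs g -> in_rkhs h ->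
  ip (a *: f + g) h = a * ip f h + ip g h.
Proof.
move=> rf rg rh; have [c c0 hc] := in_rkhs_kbound rf.
have [d d0 hd] := in_rkhs_kbound rg.
have acd0 : 0 <= `|a| * c + d by rewrite addr_ge0 ?mulr_ge0.
have rfg := in_rkhs_linear a rf rg.
apply/eqP; rewrite -subr_eq0; apply/eqP.
apply: (@norm_le_gt0_eq0 R[i] R[i]^o _ ((`|a| * c + d) * 2)).
  by rewrite mulr_ge0.
move=> e e0; have [y hy] := rh e e0; have e_0 := ltW e0.
have h1 := ipP rfg rh acd0 e_0 (kbound_linear a hc hd) hy.
have h2 := ipP rf rh c0 e_0 hc hy.
have h3 := ipP rg rh d0 e_0 hd hy.
have -> : ip (a *: f + g) h - (a * ip f h + ip g h) =
  (ip (a *: f + g) h - pairing (a *: f + g) y) -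
  (a * (ip f h - pairing f y) + (ip g h - pairing g y)).
  by rewrite pairing_linear; ring.
have -> : (`|a| * c + d) * 2 * e = (`|a| * c + d) * e + (`|a| * (c * e) + d * e).
  by ring.
apply: le_trans (ler_normB _ _) _; apply: lerD => //.
apply: le_trans (ler_normD _ _) _; apply: lerD => //.
by rewrite normrM ler_wpM2l.
Qed.

(** Only the second argument is approximated in [ip_spec], so symmetry is not visible there.
    Approximating both arguments reduces it to the hermitian symmetry of pairings of kernel
    combinations; [e <= 1] keeps the norms of the approximants bounded. *)
Lemma ipC f g : in_rkhs f -> in_rkhs g -> ip f g = (ip g f)^*.
Proof.
move=> rf rg; have [c c0 hc] := in_rkhs_kbound rf.
have [d d0 hd] := in_rkhs_kbound rg.
apply/eqP; rewrite -subr_eq0 -normr_le0.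
apply: (@le_of_le_add_gt0 _ _ _ (c + (d + 1) + (d + (c + 1)))) => //.
  by rewrite !addr_ge0.
move=> e e0 e1; have e_0 := ltW e0.
have [x hx] := rf e e0; have [y hy] := rg e e0.
have Nx : knorm x <= c + 1.
  apply: kbound_knorm; first by rewrite addr_ge0.
  have -> : kfun x = f - (f - kfun x) by rewrite subKr.
  by apply: kboundD => //; apply: kboundN; apply: kbound_le hx.
have Ny : knorm y <= d + 1.
  apply: kbound_knorm; first by rewrite addr_ge0.
  have -> : kfun y = g - (g - kfun y) by rewrite subKr.
  by apply: kboundD => //; apply: kboundN; apply: kbound_le hy.
have h1 := ipP rf rg c0 e_0 hc hy; have h2 := ipP rg rf d0 e_0 hd hx.
have h3 : `|pairing f y - pairing (kfun x) y| <= (d + 1) * e.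
  rewrite -pairingB; apply: le_trans (hx _) _.
  by rewrite mulrC ler_wpM2r.
have h4 : `|pairing g x - pairing (kfun y) x| <= (c + 1) * e.
  rewrite -pairingB; apply: le_trans (hy _) _.
  by rewrite mulrC ler_wpM2r.
have -> : ip f g - (ip g f)^* =
    (ip f g - pairing f y) + (pairing f y - pairing (kfun x) y)
    - ((ip g f - pairing g x) + (pairing g x - pairing (kfun y) x))^*.
  by rewrite !rmorphD !rmorphN /= -(pairing_kfunC x y); ring.
rewrite add0r mulrDl; apply: le_trans (ler_normB _ _) _.
rewrite norm_conjC; apply: lerD; rewrite mulrDl;
  by apply: le_trans (ler_normD _ _) _; exact: lerD.
Qed.

Lemma ip_ge0 f : in_rkhs f -> 0 <= ip f f.
Proof.
move=> rf; have [c c0 hc] := in_rkhs_kbound rf.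
apply: (@ge0_of_approx _ _ (c + (c + 1))); last first.
- move=> e e0 e1; have e_0 := ltW e0; have [x hx] := rf e e0.
  exists (pairing (kfun x) x); first exact: pairing_kfun_ge0.
  have -> : ip f f - pairing (kfun x) x =
    (ip f f - pairing f x) + (pairing f x - pairing (kfun x) x) by ring.
  apply: le_trans (ler_normD _ _) _; rewrite mulrDl; apply: lerD.
    exact: (ipP rf rf c0 e_0 hc hx).
  rewrite -pairingB mulrC; apply: le_trans (hx _) _; rewrite ler_wpM2l //.
  apply: kbound_knorm; first by rewrite addr_ge0.
  have -> : kfun x = f - (f - kfun x) by rewrite subKr.
  by apply: kboundD => //; apply: kboundN; apply: kbound_le hx.
- by rewrite !addr_ge0.
- by apply/CrealP; rewrite -ipC.
Qed.

Lemma ip_linearr a f g h : in_rkhs f -> in_rkhs g -> in_rkhs h ->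
  ip h (a *: f + g) = a^* * ip h f + ip h g.
Proof.
move=> rf rg rh; rewrite ipC ?ip_linear //; last exact: in_rkhs_linear.
by rewrite rmorphD rmorphM /= -!ipC.
Qed.

(** With [ip_kbound] this identifies the Hilbert norm with the dual norm, so the triangle inequality
    and completeness can be read off [kbound]. *)
Lemma kbound_ip f : in_rkhs f -> kbound (sqrtC (ip f f)) f.
Proof.
move=> rf y; have ry := @in_rkhs_kfun y; have f0 := ip_ge0 rf.
rewrite -(@ler_pXn2r _ 2) ?nnegrE ?mulr_ge0 ?knorm_ge0 ?sqrtC_ge0 //.
rewrite exprMn sqrtCK knorm_sqr.
apply: sqr_norm_le_of_quadratic => //; first exact: pairing_kfun_ge0.
move=> l; have rl := in_rkhs_linear (- l) ry rf.
have := ip_ge0 rl; rewrite ip_linear // !ip_linearr // !ip_kfun //.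
rewrite (ipC ry rf) ip_kfun // rmorphN /=.
by congr (0 <= _); ring.
Qed.

Lemma ip_kbound c f : in_rkhs f -> 0 <= c -> kbound c f ->
  sqrtC (ip f f) <= c.
Proof.
move=> rf c0 hc; have f0 := ip_ge0 rf.
rewrite -(@ler_pXn2r _ 2) ?nnegrE ?sqrtC_ge0 // sqrtCK.
apply: (@le_of_le_add_gt0 _ _ _ (c + c)); rewrite ?ger0_real ?exprn_ge0 ?addr_ge0 //.
move=> e e0 e1; have e_0 := ltW e0; have [x hx] := rf e e0.
rewrite -[leLHS]ger0_norm //.
have -> : ip f f = (ip f f - pairing f x) + pairing f x by ring.
apply: le_trans (ler_normD _ _) _.
have -> : c ^+ 2 + (c + c) * e = c * e + c * (c + e) by ring.
apply: lerD; first exact: (ipP rf rf c0 e_0 hc hx).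
apply: le_trans (hc x) _; rewrite ler_wpM2l //.
apply: kbound_knorm; first by rewrite addr_ge0.
have -> : kfun x = f - (f - kfun x) by rewrite subKr.
by apply: kboundD => //; apply: kboundN; apply: kbound_le hx.
Qed.

(** The positivity proof is an argument so that the type built on the predicate carries it, and the
    instances can recover it from the type. *)
Definition rkhs_pred & positive_kernel K : {pred (T -> H)} :=
  fun f => `[< in_rkhs f >].

Lemma rkhs_predP f : reflect (in_rkhs f) (f \in rkhs_pred hK).
Proof. exact: asboolP. Qed.

Lemma rkhs_pred_submod : submod_closed (rkhs_pred hK).
Proof.
split; first by apply/rkhs_predP; exact: in_rkhs0.
move=> a f g /rkhs_predP rf /rkhs_predP rg.
by apply/rkhs_predP; exact: in_rkhs_linear.
Qed.

HB.instance Definition _ :=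
  GRing.isSubmodClosed.Build R[i] (T -> H) (rkhs_pred hK) rkhs_pred_submod.

Record rkhs_space := RkhsSpace { rkhs_val :> T -> H; _ : rkhs_val \in rkhs_pred hK }.

HB.instance Definition _ := [isSub for rkhs_val].
HB.instance Definition _ := [Choice of rkhs_space by <:].
HB.instance Definition _ := [SubChoice_isSubLmodule of rkhs_space by <:].

Implicit Types F G : rkhs_space.

Lemma rkhs_valP F : in_rkhs F.
Proof. by case: F => f /= /rkhs_predP. Qed.

Definition rkhs_norm F : R[i] := sqrtC (ip F F).

Lemma rkhs_norm_ge0 F : 0 <= rkhs_norm F.
Proof. by rewrite sqrtC_ge0 ip_ge0 //; exact: rkhs_valP. Qed.

Lemma rkhs_normD F G : rkhs_norm (F + G) <= rkhs_norm F + rkhs_norm G.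
Proof.
apply: ip_kbound; [exact: rkhs_valP|by rewrite addr_ge0 ?rkhs_norm_ge0|].
by apply: kboundD; apply: kbound_ip; exact: rkhs_valP.
Qed.

Lemma rkhs_normZ a F : rkhs_norm (a *: F) = `|a| * rkhs_norm F.
Proof.
have rF := rkhs_valP F.
have r0 := in_rkhs0.
have i0 h : in_rkhs h -> ip h 0 = 0.
  move=> rh; have := ip_linearr 1 r0 r0 rh.
  rewrite conjC1 mul1r scale1r addr0 => /eqP.
  by rewrite -{1}[ip h 0]addr0 (inj_eq (addrI _)) eq_sym => /eqP.
rewrite /rkhs_norm.
have -> : (a *: F : rkhs_space) = a *: (F : T -> H) + 0 :> (T -> H).
  by rewrite addr0.
have rZ : in_rkhs (a *: (F : T -> H) + 0) by exact: in_rkhs_linear.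
rewrite (ip_linear a rF r0 rZ) (ip_linearr a rF r0 rF) (ipC r0 rZ) !i0 //.
rewrite conjC0 !addr0 mulrA sqrtCM ?nnegrE ?ip_ge0 ?mul_conjC_ge0 //.
by rewrite -normCK sqrCK.
Qed.

Lemma rkhs_norm_eq0 F : rkhs_norm F = 0 -> F = 0.
Proof.
move=> F0; apply: val_inj => /=; apply: kbound0_eq0.
by rewrite -F0; apply: kbound_ip; exact: rkhs_valP.
Qed.

HB.instance Definition _ := Lmodule_isNormed.Build R[i] rkhs_space
  rkhs_normD rkhs_normZ rkhs_norm_eq0.

End Moore.

(** A pairing involves finitely many points, so pointwise convergence is enough. *)
Lemma pairing_near (R : realType) (T Z : Type) (H : hilbertType R)
    (X : set_system Z) (g : Z -> T -> H) (f : T -> H) : Filter X ->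
  (forall t, (fun z => g z t) @ X --> f t) ->
  forall (y : seq (T * H)) (d : R[i]), 0 < d ->
    X [set z | `|pairing (g z) y - pairing f y| <= d].
Proof.
move=> XF gf; elim=> [|[t v] y IH] d d0.
  by apply: filterE => z /=; rewrite /pairing !big_nil subrr normr0 ltW.
have v1 : 0 < `|v| + 1 by rewrite ltr_wpDl.
have d2 : 0 < d / 2 by rewrite divr_gt0.
have dv : 0 < d / 2 / (`|v| + 1) by rewrite divr_gt0.
have /cvgrPdist_le/(_ _ dv) := gf t.
apply: filterS2 (IH _ d2) => z /= h1 h2.
rewrite /pairing !big_cons opprD addrACA /=; apply: le_trans (ler_normD _ _) _.
rewrite [leRHS](splitr d); apply: lerD => //.
rewrite -hdotBl; apply: le_trans (cauchy_schwarz _ _) _.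
apply: (@le_trans _ _ (d / 2 / (`|v| + 1) * (`|v| + 1))).
  by apply: ler_pM => //; rewrite ?lerDl // distrC.
by rewrite divfK ?gt_eqF.
Qed.

(** * Hilbert structure of the kernel space, and symmetries of the kernel *)

Section MooreHilbert.
Variables (R : realType) (T : Type) (H : hilbertType R) (K : T -> T -> H -> H).
Hypothesis hK : positive_kernel K.
Local Notation E := (rkhs_space hK).
Implicit Types (F G : E).

Lemma rkhs_normE F : `|F| = sqrtC (ip K F F).
Proof. by []. Qed.

Definition rkhs_dot F G : R[i] := ip K F G.

Lemma rkhs_dot_bilinear : bilinear_for
  (GRing.Scale.Law.clone _ _ ( *%R) _)
  (GRing.Scale.Law.clone _ _ (Num.conj \; *%R) _) rkhs_dot.
Proof.
split=> F a x y /=; rewrite /rkhs_dot.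
  by apply: (ip_linear hK); exact: rkhs_valP.
by apply: (ip_linearr hK); exact: rkhs_valP.
Qed.

HB.instance Definition _ := bilinear_isBilinear.Build R[i] E E R[i] _ _
  rkhs_dot rkhs_dot_bilinear.

Lemma rkhs_dot_hermitian F G :
  rkhs_dot F G = (-1) ^+ false * Num.conj (rkhs_dot G F).
Proof.
by rewrite expr0 mul1r; apply: (ipC hK); exact: rkhs_valP.
Qed.

HB.instance Definition _ := isHermitianSesquilinear.Build R[i] E false Num.conj
  rkhs_dot rkhs_dot_hermitian.

Lemma rkhs_dot_gt0 F : F != 0 -> 0 < rkhs_dot F F.
Proof.
move=> F0; rewrite lt_def (ip_ge0 hK (rkhs_valP F)) andbT.
apply: contra F0 => /eqP h; apply/eqP/rkhs_norm_eq0.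
by rewrite /rkhs_norm -/(rkhs_dot F F) h sqrtC0.
Qed.

HB.instance Definition _ := isDotProduct.Build R[i] E rkhs_dot rkhs_dot_gt0.

Lemma rkhs_kbound F c : 0 <= c -> kbound K c F <-> `|F| <= c.
Proof.
move=> c0; split=> h; first by apply: ip_kbound => //; exact: rkhs_valP.
apply: (kbound_le hK h); apply: kbound_ip => //; exact: rkhs_valP.
Qed.

Lemma rkhs_eval_bounded t :
  exists2 b : R[i], 0 <= b & forall F, `|F t| <= b * `|F|.
Proof.
have [b b0 hb] := kernel_bounded hK t; exists b => // F; rewrite mulrC.
by apply: (kbound_eval hK _ _ b0 hb) => //; apply/rkhs_kbound.
Qed.

Lemma rkhs_complete (X : set_system E) : ProperFilter X -> cauchy X -> cvg X.
Proof.
move=> XF Xc; have /cauchyP Xe := Xc.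
have Xev t : cvg ((fun F : E => F t) @ X).
  apply/cauchy_cvgP/cauchyP => e e0.
  have [b b0 hb] := rkhs_eval_bounded t.
  have b1 : 0 < b + 1 by rewrite ltr_wpDl.
  have [|F XFe] := Xe (e / (b + 1)); first by rewrite divr_gt0.
  exists (F t); suff : X [set G : E | ball (F t) e (G t)] by [].
  apply: filterS XFe => G; rewrite /= -!ball_normE /= => FG.
  have -> : F t - G t = (F - G) t by [].
  apply: le_lt_trans (hb _) _.
  apply: (@le_lt_trans _ _ ((b + 1) * `|F - G|)).
    by rewrite ler_wpM2r // lerDl.
  by rewrite mulrC -ltr_pdivlMr.
pose f t := lim ((fun F : E => F t) @ X).
have fcv t : (fun F : E => F t) @ X --> f t by exact: Xev.
(* The intermediate [G] depends on [y] and on the slack [d], but the bound [e] does not; hence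
   pointwise convergence upgrades to convergence in norm. *)
have close (F : E) e : 0 < e -> X (ball F e) -> kbound K e ((F : T -> H) - f).
  move=> e0 XFe y.
  apply: (@le_of_le_add_gt0 R[i] _ _ 1) => //.
  - by rewrite ger0_real // mulr_ge0 ?(knorm_ge0 hK) ?ltW.
  move=> d d0 _; have cvd := pairing_near XF fcv y d0.
  have [G [Gd]] := filter_ex (filterI cvd XFe).
  rewrite -ball_normE /= => FG.
  have FGb : kbound K e (F - G) by apply/rkhs_kbound; rewrite ltW.
  have -> : pairing ((F : T -> H) - f) y =
      pairing ((F : T -> H) - (G : T -> H)) y + (pairing G y - pairing f y).
    by rewrite !pairingB addrA subrK.
  apply: le_trans (ler_normD _ _) _; rewrite mul1r.
  by apply: lerD => //; exact: FGb.
have rf : in_rkhs K f.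
  move=> e e0; have [|F XFe] := Xe (e / 2); first by rewrite divr_gt0.
  have e20 : 0 < e / 2 by rewrite divr_gt0.
  have [x hx] := rkhs_valP F e20.
  exists x; have -> : f - kfun K x = - ((F : T -> H) - f) + ((F : T -> H) - kfun K x).
    by rewrite opprB addrA subrK.
  rewrite (splitr e); apply: (kboundD _ hx).
  by apply: kboundN; apply: close.
have pf : f \in rkhs_pred hK by apply/rkhs_predP.
apply/cvg_ex; exists (RkhsSpace pf).
apply/cvgrPdist_le => /= e e0.
have e20 : 0 < e / 2 by rewrite divr_gt0.
have [F XFe] := Xe _ e20.
have fF : `|RkhsSpace pf - F| <= e / 2.
  rewrite distrC; apply/rkhs_kbound; first exact: ltW.
  exact: (close F _ e20 XFe).
apply: filterS XFe => G; rewrite -ball_normE /= => FG.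
have -> : RkhsSpace pf - G = (RkhsSpace pf - F) + (F - G) by rewrite addrA subrK.
apply: le_trans (ler_normD _ _) _; rewrite [leRHS](splitr e).
by apply: lerD => //; exact: ltW.
Qed.

HB.instance Definition _ := Uniform_isComplete.Build E rkhs_complete.

Lemma rkhs_hdotE F : `|F| ^+ 2 = rkhs_dot F F.
Proof. by rewrite rkhs_normE sqrtCK. Qed.

HB.instance Definition _ := CompleteNormedModule_isHilbert.Build R E rkhs_hdotE.

Definition rkhs_eval (t : T) (F : E) : H := F t.

Lemma rkhs_eval_linear t : linear (rkhs_eval t).
Proof. by []. Qed.

HB.instance Definition _ t := GRing.isLinear.Build R[i] E H _ (rkhs_eval t)
  (rkhs_eval_linear t).

Lemma kfun_rkhs_pred x : kfun K x \in rkhs_pred hK.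
Proof. by apply/rkhs_predP; apply: in_rkhs_kfun. Qed.

Definition rkhs_gen (t : T) (v : H) : E := RkhsSpace (kfun_rkhs_pred [:: (t, v)]).

Lemma rkhs_genE s t v : rkhs_gen t v s = K s t v.
Proof. by rewrite /rkhs_gen /= /kfun big_seq1. Qed.

Lemma rkhs_gen_linear t : linear (rkhs_gen t).
Proof.
move=> a v w; apply: val_inj; apply/funext => s.
rewrite [LHS](rkhs_genE s t).
rewrite [RHS](_ : _ = a *: rkhs_gen t v s + rkhs_gen t w s) // !rkhs_genE.
exact: kernel_linear.
Qed.

HB.instance Definition _ t := GRing.isLinear.Build R[i] H E _ (rkhs_gen t)
  (rkhs_gen_linear t).

Lemma rkhs_eval_continuous t : continuous (rkhs_eval t).
Proof.
have [b b0 hb] := rkhs_eval_bounded t.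
exact: (@bounded_continuous _ E H (rkhs_eval t) b b0 hb).
Qed.

Lemma rkhs_eval_adjoint t : adjoint (rkhs_eval t) (rkhs_gen t).
Proof.
move=> F v; rewrite /rkhs_eval.
rewrite [RHS](_ : _ = ip K F (kfun K [:: (t, v)])) //.
by rewrite (ip_kfun hK) ?/pairing ?big_seq1 //; exact: rkhs_valP.
Qed.

Definition moore_rkhs : rkhs K := {|
  rkhs_sort := E;
  rkhs_ev := rkhs_eval;
  rkhs_ev_adj := rkhs_gen;
  rkhs_ext := fun F G (h : forall s, F s = G s) => val_inj (funext h);
  rkhs_ev_continuous := rkhs_eval_continuous;
  rkhs_ev_adjoint := rkhs_eval_adjoint;
  rkhs_kernel := rkhs_genE
|}.

Variables (phi psi : T -> T).
Hypothesis phiK : cancel phi psi.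
Hypothesis psiK : cancel psi phi.
Hypothesis Kphi : forall s t v, K (phi s) (phi t) v = K s t v.

Let relabel (u : T -> T) (x : seq (T * H)) := [seq (u p.1, p.2) | p <- x].

Lemma pairing_comp f x : pairing (f \o phi) x = pairing f (relabel phi x).
Proof. by rewrite /pairing big_map. Qed.

Lemma kfun_comp x : kfun K x \o phi = kfun K (relabel psi x).
Proof.
apply/funext => t; rewrite /kfun /= big_map; apply: eq_bigr => p _ /=.
by rewrite -(Kphi t) psiK.
Qed.

(** Composition with [phi] moves the points of a test list by [phi] and the centres of kernel
    sections by [psi]; the two relabellings cancel. *)
Lemma knorm_relabel x : knorm K (relabel phi x) = knorm K x.
Proof.
rewrite /knorm -pairing_comp kfun_comp (_ : relabel psi (relabel phi x) = x) //.
by rewrite /relabel -map_comp; elim: x => //= -[t v] x ->; rewrite /= phiK.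
Qed.

Lemma kbound_comp c f : kbound K c f -> kbound K c (f \o phi).
Proof. by move=> h y; rewrite pairing_comp -(knorm_relabel y); apply: h. Qed.

Lemma rkhs_pred_comp F : F \o phi \in rkhs_pred hK.
Proof.
apply/rkhs_predP => e e0; have [x hx] := rkhs_valP F e0.
by exists (relabel psi x); rewrite -kfun_comp; apply: (kbound_comp hx).
Qed.

Definition rkhs_comp F : E := RkhsSpace (rkhs_pred_comp F).

Lemma rkhs_comp_linear : linear rkhs_comp.
Proof. by move=> a F G; apply: val_inj. Qed.

HB.instance Definition _ := GRing.isLinear.Build R[i] E E _ rkhs_comp
  rkhs_comp_linear.

End MooreHilbert.

(** The common source of time translation and time reflection, both of which preserve [|s - t|]. *)
Lemma rkhs_composition (R : realType) (T : Type) (H : hilbertType R)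
    (K : T -> T -> H -> H) (hK : positive_kernel K) (phi psi : T -> T) :
  cancel phi psi -> cancel psi phi ->
  (forall s t v, K (phi s) (phi t) v = K s t v) ->
  exists W : {linear moore_rkhs hK -> moore_rkhs hK},
    forall F s, rkhs_ev _ s (W F) = rkhs_ev _ (phi s) F.
Proof.
move=> h1 h2 h3.
by exists (rkhs_comp (hK := hK) h1 h2 h3).
Qed.

(** * The kernel of a contraction semigroup *)

Section SemigroupKernel.
Variables (R : realType) (H : hilbertType R) (C : R -> {linear H -> H}).
Hypothesis hC : contraction_semigroup C.

Let K (s t : R) (v : H) : H := C `|s - t| v.

Let quad (x : seq (R * H)) :=
  \sum_(q <- x) \sum_(p <- x) '[< K q.1 p.1 p.2, q.2 >].

Lemma semigroup_kernel_hermitian s t v w : '[< K s t v, w >] = '[< v, K t s w >].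
Proof. by rewrite /K (distrC t) (contraction_semigroup_hermitian hC). Qed.

Lemma semigroup_quad_cons t v y : quad ((t, v) :: y) = '[< v, v >] + quad y +
  (\sum_(q <- y) '[< K q.1 t v, q.2 >] + (\sum_(q <- y) '[< K q.1 t v, q.2 >])^*).
Proof.
rewrite /quad !big_cons /=; under [X in _ + X = _]eq_bigr do rewrite big_cons.
rewrite big_split /= {1}/K subrr normr0 (contraction_semigroup0 hC).
have -> : \sum_(p <- y) '[< K t p.1 p.2, v >] =
    (\sum_(q <- y) '[< K q.1 t v, q.2 >])^*.
  rewrite rmorph_sum; apply: eq_bigr => p _.
  by rewrite semigroup_kernel_hermitian; exact: hdotC.
by ring.
Qed.

(** After a shift two masses sit at the same time; merging them shortens the list and drives the
    induction on its length. *)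
Lemma semigroup_quad_merge t v w y :
  quad ((t, v) :: (t, w) :: y) = quad ((t, v + w) :: y).
Proof.
have Ktt z : K t t z = z.
  by rewrite /K subrr normr0 (contraction_semigroup0 hC).
rewrite !semigroup_quad_cons !big_cons /= !Ktt.
have -> : \sum_(q <- y) '[< K q.1 t (v + w), q.2 >] =
    \sum_(q <- y) '[< K q.1 t v, q.2 >] + \sum_(q <- y) '[< K q.1 t w, q.2 >].
  rewrite -big_split; apply: eq_bigr => q _ /=.
  by rewrite /K linearD hdotDl.
by rewrite !hdotDl !hdotDr !rmorphD /= -(hdotC w v); ring.
Qed.

(* Moving the leftmost mass [v] at time [t] forward to the next time [u]
   replaces it by [C (u - t) v]; the cross terms do not change, by the semigroup
   law, and the diagonal term can only decrease. *)
Lemma semigroup_quad_shift t u v y : t <= u -> all (fun q => u <= q.1) y ->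
  quad ((u, C (u - t) v) :: y) <= quad ((t, v) :: y).
Proof.
move=> tu uy; rewrite !semigroup_quad_cons.
have -> : \sum_(q <- y) '[< K q.1 u (C (u - t) v), q.2 >] =
    \sum_(q <- y) '[< K q.1 t v, q.2 >].
  rewrite !big_seq; apply: eq_bigr => q qy; congr '[< _, _ >].
  have uq : u <= q.1 by exact: (allP uy).
  rewrite /K !ger0_norm ?subr_ge0 ?(le_trans tu) //.
  by rewrite -(contraction_semigroupD hC) ?subr_ge0 // addrA subrK.
rewrite lerD2r lerD2r -!hdotE ler_pXn2r ?nnegrE //.
by apply: (contraction_semigroup_contraction hC); rewrite subr_ge0.
Qed.

Lemma semigroup_quad_sorted n x : size x = n ->
  sorted (fun p q : R * H => p.1 <= q.1) x -> 0 <= quad x.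
Proof.
have tr : transitive (fun p q : R * H => p.1 <= q.1).
  by move=> b a c; exact: le_trans.
elim: n x => [|n IH] [|[t v] y] //; first by rewrite /quad big_nil.
case: y => [_ _|[u w] y [sy] /= /andP[tu py]].
  rewrite semigroup_quad_cons /quad !big_nil conjC0 !addr0.
  exact: hdot_ge0.
have uy := order_path_min tr py.
apply: le_trans (semigroup_quad_shift _ (y := (u, w) :: y) tu _); last first.
  by rewrite /= lexx.
rewrite semigroup_quad_merge; apply: IH; first by rewrite -sy.
by case: y {sy uy} py.
Qed.

Lemma semigroup_positive_kernel : positive_kernel K.
Proof.
split=> [s t a v w|s t v w|x|s].
- by rewrite /K linearP.
- exact: semigroup_kernel_hermitian.
(* The double sum is invariant under permutation, so the masses may be ordered by time. *)
- pose y := sort (fun p q : R * H => p.1 <= q.1) x.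
  have xy : perm_eq x y by rewrite perm_sym perm_sort.
  rewrite (perm_big _ xy) /=; under eq_bigr do rewrite (perm_big _ xy) /=.
  apply: (@semigroup_quad_sorted (size y)) => //.
  by apply: sort_sorted => p q; exact: le_total.
- exists 1 => // v; rewrite mul1r hdotE /K subrr normr0.
  by rewrite (contraction_semigroup0 hC).
Qed.

Theorem minimal_dilation_exists : inhabited (minimal_dilation C).
Proof.
pose hK := semigroup_positive_kernel.
have shift t : exists W : {linear moore_rkhs hK -> moore_rkhs hK},
    forall F s, rkhs_ev _ s (W F) = rkhs_ev _ (s + t) F.
  apply: (@rkhs_composition _ _ _ _ hK _ (fun s => s - t)) => [s|s|s r v].
  - exact: addrK.
  - exact: subrK.
  - by rewrite /K opprD addrACA subrr addr0.
have [W hW] := choice shift.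
have [Th hTh] : exists W : {linear moore_rkhs hK -> moore_rkhs hK},
    forall F s, rkhs_ev _ s (W F) = rkhs_ev _ (- s) F.
  apply: (rkhs_composition hK opprK opprK) => s r v.
  by rewrite /K -opprD normrN.
by constructor; exact: (@MinimalDilation R H C (moore_rkhs hK) W Th hW hTh).
Qed.

End SemigroupKernel.

(** * The minimal unitary dilation *)

Section Dilation.
Variables (R : realType) (H : hilbertType R) (C : R -> {linear H -> H}).
Hypothesis hC : contraction_semigroup C.
Variable D : minimal_dilation C.

Local Notation ev s := (rkhs_ev D s).
Local Notation ea s := (rkhs_ev_adj D s).
Implicit Types (f g : D) (s t : R) (v w : H).

Lemma dil_evK s t v : ev s (ea t v) = C `|s - t| v.
Proof. exact: rkhs_kernel. Qed.

Lemma dil_hdot s f v : '[< ev s f, v >] = '[< f, ea s v >].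
Proof. exact: rkhs_ev_adjoint. Qed.

Lemma dil_hdot_gen s t v w : '[< ea s v, ea t w >] = '[< C `|t - s| v, w >].
Proof. by rewrite -dil_hdot dil_evK. Qed.

Definition dil_gen (p : R * H) : D := ea p.1 p.2.

Lemma dil_gen_total : closure (lspan (range dil_gen)) = setT.
Proof.
apply: clspan_total => z hz; apply: rkhs_ext => t.
rewrite linear0; apply: hdot_eq0; rewrite dil_hdot hdotC (hz (ea t (ev t z))).
  exact: conjC0.
by exists (t, ev t z).
Qed.

(** Composing functions with [phi] acts on the centres of kernel sections by the inverse of [phi];
    this is where the sign in [dil_U_gen] comes from. *)
Lemma dil_comp_gen (W : {linear D -> D}) (phi : R -> R) :
  (forall s t, `|phi s - phi t| = `|s - t|) ->
  (forall f s, ev s (W f) = ev (phi s) f) ->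
  forall s v, W (ea (phi s) v) = ea s v.
Proof.
move=> h hW s v; apply: rkhs_ext => r.
by rewrite hW !dil_evK h.
Qed.

Lemma dil_comp_unitary (W : {linear D -> D}) (phi psi : R -> R) :
  cancel psi phi ->
  (forall s t, `|phi s - phi t| = `|s - t|) ->
  (forall f s, ev s (W f) = ev (phi s) f) -> unitary W.
Proof.
move=> psiK h hW.
have [|||V [uV VE]] := @isometry_extension R (R * H) D D
    (fun p => dil_gen (phi p.1, p.2)) dil_gen.
- by move=> [s v] [t w]; rewrite /dil_gen /= !dil_hdot_gen h.
- rewrite -dil_gen_total; congr (closure (lspan _)).
  apply/seteqP; split=> _ [[s v] _ <-]; first by exists (phi s, v).
  by exists (psi s, v) => //=; rewrite psiK.
- exact: dil_gen_total.
(* Both sides have the inner product of [f] with the section at [phi s] as their inner product with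
   the section at [s]. *)
have VW f : V f = W f.
  apply: rkhs_ext => s; apply: hdot_eqP => v.
  have := VE (s, v); rewrite /dil_gen /= => VEs.
  by rewrite hW !dil_hdot -{1}VEs uV.1.
split; first by move=> x y; rewrite -!VW uV.1.
exact: eq_bij uV.2 _ VW.
Qed.

Lemma dil_U_gen t s v : dil_U D t (ea s v) = ea (s - t) v.
Proof.
rewrite -{1}(subrK t s); apply: (@dil_comp_gen _ (fun s => s + t)).
  by move=> r r'; rewrite opprD addrACA subrr addr0.
exact: dil_UE.
Qed.

Lemma dil_theta_gen s v : dil_theta D (ea s v) = ea (- s) v.
Proof.
rewrite -{1}(opprK s); apply: (@dil_comp_gen _ -%R).
  by move=> r r'; rewrite -opprD normrN.
exact: dil_thetaE.
Qed.

Lemma dil_U_unitary t : unitary (dil_U D t).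
Proof.
apply: (@dil_comp_unitary _ (fun s => s + t) (fun s => s - t)).
- by move=> s; exact: subrK.
- by move=> r r'; rewrite opprD addrACA subrr addr0.
- exact: dil_UE.
Qed.

Lemma dil_theta_unitary : unitary (dil_theta D).
Proof.
apply: (@dil_comp_unitary _ -%R -%R); first exact: opprK.
  by move=> r r'; rewrite -opprD normrN.
exact: dil_thetaE.
Qed.

Lemma dil_thetaK : involutive (dil_theta D).
Proof. by move=> f; apply: rkhs_ext => s; rewrite !dil_thetaE opprK. Qed.

Lemma dil_theta_hdot f g : '[< dil_theta D f, g >] = '[< f, dil_theta D g >].
Proof. by rewrite -{1}(dil_thetaK g) dil_theta_unitary.1. Qed.

Lemma dil_ev0K v : ev 0 (ea 0 v) = v.
Proof. by rewrite dil_evK subrr normr0 (contraction_semigroup0 hC). Qed.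

Lemma semigroup_near0 v e : 0 < e ->
  exists2 d : R, 0 < d & forall h, 0 <= h -> h < d -> `|v - C h v| <= e.
Proof.
move=> e0; have hc0 := @contraction_semigroup_continuous _ _ _ hC v.
move/subspace_continuousP : hc0 => hc.
have : C t v @[t --> within `[0, +oo[ (nbhs (0 : R))] --> C 0 v.
  by apply: hc; rewrite /= in_itv /= lexx.
rewrite (contraction_semigroup0 hC) => /cvgrPdist_le/(_ e e0).
rewrite near_withinE => /nbhs_ballP[d /= d0 dV]; exists d => // h h0 hd.
apply: dV; first by rewrite /ball /= sub0r normrN ger0_norm.
by rewrite /= in_itv /= h0.
Qed.

(** The vectors with this property form a closed subspace, by unitarity of [dil_U]. On a section
    with vector [v] the square of the displacement is twice the real part of
    ['[< v - C |h| v, v >]], so right continuity of [C] at [0] suffices. *)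
Lemma dil_U_near0 f e : 0 < e ->
  exists2 d : R, 0 < d & forall h, `|h| < d -> `|f - dil_U D h f| <= e.
Proof.
pose M : set D := [set f | forall e : R[i], 0 < e ->
  exists2 d : R, 0 < d & forall h, `|h| < d -> `|f - dil_U D h f| <= e].
suff : closure (lspan (range dil_gen)) `<=` M by rewrite dil_gen_total => hM; exact: (hM f I e).
move=> {f e}; have Mlin : submod_closed [in M].
  apply/submod_closedP; split=> [e e0|a f g hf hg e e0].
    by exists 1 => // h _; rewrite linear0 subrr normr0 ltW.
  have a1 : 0 < `|a| + 1 by rewrite ltr_wpDl.
  have [|d1 d10 h1] := hf (e / 2 / (`|a| + 1)); first by rewrite !divr_gt0.
  have [|d2 d20 h2] := hg (e / 2); first by rewrite divr_gt0.
  exists (Num.min d1 d2); first by rewrite lt_min d10.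
  move=> h; rewrite lt_min => /andP[hd1 hd2].
  rewrite linearP opprD addrACA -scalerBr.
  apply: le_trans (ler_normD _ _) _; rewrite [leRHS](splitr e).
  apply: lerD; last exact: h2.
  rewrite normrZ; apply: (@le_trans _ _ ((`|a| + 1) * (e / 2 / (`|a| + 1)))).
    by apply: ler_pM => //; rewrite ?lerDl // h1.
  by rewrite mulrC divfK ?gt_eqF.
have Mcl : closure M `<=` M.
  move=> f /closure_normP cf e e0.
  have e3 : 0 < e / 3 by rewrite divr_gt0.
  have [g Mg fg] := cf _ e3; have [d d0 hd] := Mg _ e3.
  exists d => // h /hd hg.
  have -> : f - dil_U D h f = (f - g) + (g - dil_U D h g) - dil_U D h (f - g).
    by rewrite linearB opprB !addrA !subrK.
  have -> : e = e / 3 + e / 3 + e / 3 by field.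
  apply: le_trans (ler_normB _ _) _; apply: lerD; last first.
    by rewrite (unitary_norm (dil_U_unitary h)).
  by apply: le_trans (ler_normD _ _) _; apply: lerD.
apply: clspan_min => //.
move=> _ [[s v] _ <-] e e0; rewrite /dil_gen /=.
have v1 : 0 < 2 * (`|v| + 1) by rewrite mulr_gt0 // ltr_wpDl.
(* Chosen so that twice this bound times [|v|] is at most [e ^+ 2]; the [+ 1] covers [v = 0]. *)
have [|d d0 hd] := @semigroup_near0 v (e ^+ 2 / (2 * (`|v| + 1))).
  by rewrite divr_gt0 // exprn_gt0.
exists d => // h /hd hh; rewrite dil_U_gen.
rewrite -(@ler_pXn2r _ 2) ?nnegrE ?(ltW e0) //.
rewrite norm_sub_sqr !dil_hdot_gen.
have -> : s - h - s = - h by rewrite addrAC subrr sub0r.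
rewrite !subrr normr0 normrN (contraction_semigroup0 hC).
have -> : '[< v, v >] + '[< v, v >] - ('[< C `|h| v, v >] + '[< C `|h| v, v >]^*) =
    '[< v - C `|h| v, v >] + '[< v - C `|h| v, v >]^*.
  by rewrite hdotBl rmorphB /= -(hdotC v v); ring.
have hn := le_trans (cauchy_schwarz (v - C `|h| v) v)
  (ler_wpM2r (normr_ge0 v) (hh (normr_ge0 h))).
set z := '[< _, _ >] in hn *.
have zr : z + z^* \is Num.real.
  by apply/CrealP; rewrite rmorphD /= conjCK addrC.
apply: le_trans (real_ler_norm zr) _.
apply: le_trans (ler_normD _ _) _; rewrite norm_conjC.
apply: le_trans (lerD hn hn) _.
rewrite -mulr2n.
have -> : e ^+ 2 / (2 * (`|v| + 1)) * `|v| *+ 2 = e ^+ 2 * (`|v| / (`|v| + 1)).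
  by field; rewrite gt_eqF // ltr_wpDl.
rewrite ler_piMr ?exprn_ge0 ?(ltW e0) // ler_pdivrMr ?mul1r ?lerDl //.
Qed.

Lemma dil_unitary_group : unitary_group (dil_U D).
Proof.
have UD s t f : dil_U D (s + t) f = dil_U D s (dil_U D t f).
  by apply: rkhs_ext => r; rewrite !dil_UE addrA.
split=> //; first exact: dil_U_unitary.
  by move=> f; apply: rkhs_ext => r; rewrite dil_UE addr0.
move=> f t; apply/cvgrPdist_le => e e0.
have [d d0 hd] := dil_U_near0 f e0.
apply/nbhs_ballP; exists d => //= s ts.
have -> : dil_U D s f = dil_U D t (dil_U D (s - t) f) by rewrite -UD addrC subrK.
rewrite -raddfB (unitary_norm (dil_U_unitary t)); apply: hd.
by rewrite distrC.
Qed.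

End Dilation.

(** * The dilation as a euclidean realization *)

Section ReflectionPositive.
Variable R : realType.

Lemma closed_unitary_preimage (E F : hilbertType R) (V : {linear E -> F})
    (M : set F) : unitary V -> closed M -> closed (V @^-1` M).
Proof.
move=> uV cM; apply: closed_comp cM => x _.
by apply: (@bounded_continuous _ _ _ V 1) => // y; rewrite mul1r unitary_norm.
Qed.

Variable X : rp_space R.
Local Notation theta := (@rp_theta R X).
Local Notation E0 := (@rp_zero R X).
Local Notation Ep := (@rp_plus R X).

Lemma rp_theta_hdot (x y : X) : '[< theta x, y >] = '[< x, theta y >].
Proof. by rewrite -{1}(rp_thetaK y) (rp_theta_unitary X).1. Qed.

Lemma rp_zero_submod : submod_closed [in E0].
Proof.
apply/submod_closedP; have /submod_closedP[p0 pl] := rp_plus_submod X.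
split; first by split; rewrite ?linear0.
by move=> a x y [px tx] [py ty]; split; [exact: pl|rewrite linearP tx ty].
Qed.

Lemma rp_zero_closed : closed E0.
Proof.
apply: closedI; first exact: rp_plus_closed.
(* As [theta] is symmetric, its fixed vectors are those orthogonal to every [theta z - z]. *)
have -> : (fun x : X => theta x = x) =
    \bigcap_(z in setT) [set x | '[< x, theta z - z >] = 0].
  apply/seteqP; split=> [x tx z _ /=|x h].
    by rewrite hdotBr -rp_theta_hdot tx subrr.
  apply: hdot_eqP => z; rewrite rp_theta_hdot.
  by apply/eqP; rewrite -subr_eq0 -hdotBr; apply/eqP/h.
by apply: closed_bigI => z _; exact: closed_hdotl.
Qed.

Lemma rp_minus_submod : submod_closed [in @rp_minus R X].
Proof. by apply: unitary_image_submod; exact: rp_plus_submod. Qed.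

Lemma rp_minus_closed : closed (@rp_minus R X).
Proof.
have -> : @rp_minus R X = theta @^-1` Ep.
  apply/seteqP; split=> [_ [x px <-]|x px]; first by rewrite /preimage /= rp_thetaK.
  by exists (theta x) => //; rewrite rp_thetaK.
by apply: closed_unitary_preimage; [exact: rp_theta_unitary|exact: rp_plus_closed].
Qed.

End ReflectionPositive.

Section Realization.
Variables (R : realType) (H : hilbertType R) (C : R -> {linear H -> H}).
Hypothesis hC : contraction_semigroup C.
Variable D : minimal_dilation C.

Local Notation Dplus := (@dil_plus R H C D).
Local Notation Dzero := (@dil_zero R H C D).
Local Notation ev s := (rkhs_ev D s).
Local Notation ea s := (rkhs_ev_adj D s).
Implicit Types (f g : D) (s t : R) (v w : H).

Let gens : set D := \bigcup_(t in [set t | 0 < t]) (dil_U D t @` Dzero).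

Lemma dil_gensE : gens = [set f | exists t v, 0 < t /\ f = ea (- t) v].
Proof.
apply/seteqP; split=> [_ [t t0 [_ [v _ <-] <-]]|_ [t [v [t0 ->]]]].
  by exists t, v; rewrite dil_U_gen sub0r.
exists t => //; exists (ea 0 v); first by exists v.
by rewrite dil_U_gen sub0r.
Qed.

Lemma dil_plus_gen t v : 0 < t -> Dplus (ea (- t) v).
Proof.
by move=> t0; apply: sub_clspan; rewrite -/gens dil_gensE; exists t, v.
Qed.

Lemma dil_plus_orthogonal z : (forall t v, 0 < t -> '[< ea (- t) v, z >] = 0) ->
  forall f, Dplus f -> '[< f, z >] = 0.
Proof.
move=> h; apply: clspan_orthogonal => f.
by rewrite -/gens dil_gensE => -[t [v [t0 ->]]]; exact: h.
Qed.

Lemma dil_plus_submod : submod_closed [in Dplus].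
Proof. exact: clspan_submod. Qed.

Lemma dil_plus_closed : closed (Dplus).
Proof. exact: closed_closure. Qed.

(** The generators have strictly positive times, so time [0] is reached only as a limit of small
    translates. *)
Lemma dil_plus_zero v : Dplus (ea 0 v).
Proof.
rewrite (closure_id (Dplus)).1; last exact: dil_plus_closed.
apply/closure_normP => e e0.
have [d d0 hd] := dil_U_near0 hC (ea 0 v) e0.
exists (dil_U D (d / 2) (ea 0 v)).
  by rewrite dil_U_gen sub0r; apply: dil_plus_gen; rewrite divr_gt0.
apply: hd; rewrite ger0_norm; last by rewrite divr_ge0 // ltW.
by rewrite ltr_pdivrMr // ltr_pMr // ltr1n.
Qed.

(** On the section at [- s] with [s > 0] this reads [C (t + s) v = C t (C s v)]. Written as
    orthogonality to [ea t w - ea 0 (C t w)], it passes to the closed span. *)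
Lemma dil_plus_ev f t : Dplus f -> 0 <= t -> ev t f = C t (ev 0 f).
Proof.
move=> pf t0; apply: hdot_eqP => w.
rewrite (contraction_semigroup_hermitian hC) // !dil_hdot.
apply/eqP; rewrite -subr_eq0 -hdotBr; apply/eqP.
apply: dil_plus_orthogonal pf => s v s0.
have s_0 := ltW s0.
rewrite hdotBr !dil_hdot_gen sub0r !opprK.
rewrite !ger0_norm // ?addr_ge0 //.
rewrite (contraction_semigroupD hC) //.
by rewrite (contraction_semigroup_hermitian hC) // subrr.
Qed.

(** For [f = ea (- s) v] the reflection moves to [ea s v] and reads off [ev s g], which is
    [C s (ev 0 g)]; hermiticity returns [C s] to [v], giving [ev 0 f]. *)
Lemma dil_plus_theta f g : Dplus f -> Dplus g ->
  '[< f, dil_theta D g >] = '[< ev 0 f, ev 0 g >].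
Proof.
move=> pf pg; apply/eqP; rewrite dil_hdot -subr_eq0 -hdotBr; apply/eqP.
apply: dil_plus_orthogonal pf => s v s0.
rewrite hdotBr -dil_theta_hdot // dil_theta_gen opprK.
rewrite -dil_hdot dil_evK sub0r opprK hdotC -dil_hdot.
rewrite (dil_plus_ev pg (ltW s0)) ger0_norm ?(ltW s0) //.
by rewrite (contraction_semigroup_hermitian hC) ?(ltW s0) // -hdotC subrr.
Qed.

Lemma dil_plus_U t f : 0 < t -> Dplus f -> Dplus (dil_U D t f).
Proof.
move=> t0; suff h : Dplus `<=` dil_U D t @^-1` Dplus by apply: h.
apply: clspan_min.
- by apply: preimage_submod; exact: dil_plus_submod.
- by apply: closed_unitary_preimage; [exact: dil_U_unitary|exact: dil_plus_closed].
rewrite -/gens dil_gensE => _ [s [v [s0 ->]]].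
rewrite /preimage /= dil_U_gen -opprD; apply: dil_plus_gen.
exact: addr_gt0.
Qed.

Lemma dil_positive f : Dplus f -> 0 <= '[< f, dil_theta D f >].
Proof. by move=> pf; rewrite dil_plus_theta // hdot_ge0. Qed.

Definition dil_rp : rp_space R := RpSpace dil_plus_submod dil_plus_closed
  (dil_theta_unitary D) (@dil_thetaK _ _ _ D) dil_positive.

(** A fixed [f] satisfies [|f| = |ev 0 f|], and expanding the square of its distance to
    [ea 0 (ev 0 f)] then gives zero. *)
Lemma dil_rp_zero : @rp_zero R dil_rp = Dzero.
Proof.
apply/seteqP; split=> [f [pf tf]|_ [v _ <-]]; last first.
  by split; [exact: dil_plus_zero|rewrite /= dil_theta_gen oppr0].
exists (ev 0 f) => //; apply/esym/eqP; rewrite -subr_eq0; apply/eqP/hdot_eq0.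
have ff : '[< f, f >] = '[< ev 0 f, ev 0 f >].
  have {}tf : dil_theta D f = f := tf.
  by have := dil_plus_theta pf pf; rewrite tf.
rewrite -hdotE norm_sub_sqr ff dil_hdot_gen subrr normr0.
rewrite (contraction_semigroup0 hC) -dil_hdot -(hdotC (ev 0 f)).
by rewrite subrr.
Qed.

Lemma dil_rp_quotient_linear (a : R[i]) (f g : dil_rp) :
  ev 0 (a *: f + g) = a *: ev 0 f + ev 0 g.
Proof. by rewrite linearP. Qed.

Lemma dil_rp_quotient_norm (f : dil_rp) : @rp_plus R dil_rp f ->
  `|ev 0 f| = sqrtC '[< f, rp_theta dil_rp f >].
Proof. by move=> pf; rewrite norm_sqrtC dil_plus_theta. Qed.

Lemma dil_rp_quotient_dense : closure (ev 0 @` Dplus) = setT.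
Proof.
apply/seteqP; split => // v _; apply: subset_closure.
by exists (ea 0 v); [exact: dil_plus_zero|rewrite (dil_ev0K hC)].
Qed.

(** The completion is realised by [H] itself, so the induced semigroup is literally [C] and the
    intertwiner is the identity. *)
Definition dil_rp_quotient : os_quotient dil_rp :=
  @OsQuotient R dil_rp H (ev 0) (fun a f g _ _ => dil_rp_quotient_linear a f g)
    dil_rp_quotient_norm dil_rp_quotient_dense.

Lemma dil_rp_realizes : euclidean_realization C (dil_U D : R -> {linear dil_rp -> dil_rp}).
Proof.
exists dil_rp_quotient, C, (idfun : {linear H -> H}); split=> //.
- split; first exact: dil_unitary_group.
    by move=> t f t0 pf; exact: dil_plus_U.
  move=> t f; apply: rkhs_ext => s /=.
  by rewrite dil_thetaE !dil_UE dil_thetaE opprD opprK.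
- move=> t f t0 pf /=; rewrite dil_UE add0r.
  by rewrite (dil_plus_ev pf t0).
Qed.

(** The projection onto the fixed space is [ea 0] after [ev 0]. For [y = theta f] and [g] in the
    positive space, [y] and [ea 0 (ev 0 y)] have the same inner product with [g], namely that of
    [ev 0 f] with [ev 0 g]. *)
Lemma dil_rp_markov : markov_type dil_rp.
Proof.
move=> x /=; set y := orthoproj _ x.
have [[f pf fE] _] := orthoprojP x (@rp_minus_submod _ dil_rp) (@rp_minus_closed _ dil_rp).
rewrite -/y /= in fE.
have p0 : orthoproj (@rp_zero R dil_rp) y = ea 0 (ev 0 y).
  apply: orthoproj_eq; [exact: rp_zero_submod|exact: rp_zero_closed| |].
    by rewrite dil_rp_zero; exists (ev 0 y).
  rewrite dil_rp_zero => _ [v _ <-].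
  by rewrite hdotBl -!dil_hdot (dil_ev0K hC) subrr.
have pp z : Dplus z -> orthoproj (@rp_plus R dil_rp) z = z.
  move=> pz; apply: orthoproj_eq => //; [exact: dil_plus_submod|exact: dil_plus_closed|].
  by move=> w _; rewrite subrr hdot0l.
rewrite p0 pp; last exact: dil_plus_zero.
apply/esym/orthoproj_eq; [exact: dil_plus_submod|exact: dil_plus_closed| |].
  exact: dil_plus_zero.
move=> g pg; rewrite hdotBl -fE dil_theta_hdot dil_plus_theta //.
rewrite dil_thetaE oppr0 (hdotC (ea 0 _)) -dil_hdot -(hdotC (ev 0 f)).
by rewrite subrr.
Qed.

Lemma dil_rp_cyclic : zero_cyclic (dil_U D : R -> {linear dil_rp -> dil_rp}).
Proof.
rewrite /zero_cyclic dil_rp_zero -(dil_gen_total D); congr (closure (lspan _)).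
apply/seteqP; split=> [_ [t _ [_ [v _ <-] <-]]|_ [[s v] _ <-]].
  by exists (- t, v) => //; rewrite dil_U_gen sub0r.
exists (- s) => //; exists (ea 0 v); first by exists v.
by rewrite dil_U_gen sub0r opprK.
Qed.

Lemma dil_rp_generated : plus_generated (dil_U D : R -> {linear dil_rp -> dil_rp}).
Proof. by rewrite /plus_generated dil_rp_zero. Qed.

End Realization.

(** * Uniqueness *)

Section Uniqueness.
Variable R : realType.

Lemma isometry_ext (E F : hilbertType R) (f g : {linear E -> F}) (A : set E) :
  (forall x, `|f x| = `|x|) -> (forall x, `|g x| = `|x|) ->
  closure (lspan A) = setT -> (forall x, A x -> f x = g x) -> f =1 g.
Proof.
move=> nf ng tA fg x; apply/eqP; rewrite -subr_eq0; apply/eqP.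
have sA : lspan A `<=` [set x | f x = g x].
  apply: lspan_min => //; apply/submod_closedP; split; first by rewrite /= !linear0.
  by move=> a y z /= hy hz; rewrite !linearP hy hz.
apply: (@norm_le_gt0_eq0 _ _ _ 2) => // e e0.
have /closure_normP/(_ e e0)[y Ay xy] : closure (lspan A) x by rewrite tA.
have -> : f x - g x = f (x - y) - g (x - y).
  by rewrite (linearB f) (linearB g) (sA y Ay) opprB addrA subrK.
apply: le_trans (ler_normB _ _) _; rewrite nf ng mulr_natl mulr2n.
exact: lerD.
Qed.

Variables (H : hilbertType R) (C : R -> {linear H -> H}) (X : rp_space R)
  (U : R -> {linear X -> X}) (Q : os_quotient X) (Uhat : R -> {linear Q -> Q})
  (G : {linear Q -> H}).
Hypothesis hC : contraction_semigroup C.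
Hypothesis hU : realizes C U Uhat G.
Hypothesis markov : markov_type X.
Hypothesis cyclic : zero_cyclic U.
Hypothesis generated : plus_generated U.

Local Notation theta := (rp_theta X).
Local Notation E0 := (@rp_zero R X).
Local Notation Ep := (@rp_plus R X).
Local Notation q := (os_q Q).
Implicit Types x y : X.

Let uU : unitary_group U := rp_unitary_group_group (realizes_group hU).

Lemma os_qD x y : Ep x -> Ep y -> q (x + y) = q x + q y.
Proof. by move=> px py; have := os_q_linear Q 1 px py; rewrite !scale1r. Qed.

Lemma os_q0 : q 0 = 0.
Proof.
have p0 : Ep 0 by have /submod_closedP[] := rp_plus_submod X.
by have := os_q_linear Q (-1) p0 p0; rewrite !scaleN1r !addNr.
Qed.

Lemma os_qZ (a : R[i]) x : Ep x -> q (a *: x) = a *: q x.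
Proof.
have p0 : Ep 0 by have /submod_closedP[] := rp_plus_submod X.
by move=> px; have := os_q_linear Q a px p0; rewrite os_q0 !addr0.
Qed.

Lemma os_qB x y : Ep x -> Ep y -> q (x - y) = q x - q y.
Proof.
move=> px py; rewrite -(scaleN1r y) os_qD ?os_qZ ?scaleN1r //.
by rewrite -scaleN1r; apply: submodZ => //; exact: rp_plus_submod.
Qed.

(** The quotient prescribes norms only; polarization recovers the form, as [theta] is symmetric. *)
Lemma os_q_hdot x y : Ep x -> Ep y -> '[< q x, q y >] = '[< x, theta y >].
Proof.
have hd z : Ep z -> '[< q z, q z >] = '[< z, theta z >].
  by move=> pz; rewrite -hdotE os_q_norm // sqrtCK.
move=> px py; have pm := rp_plus_submod X.
have tC : '[< y, theta x >] = '[< x, theta y >]^*.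
  by rewrite -rp_theta_hdot; exact: hdotC.
apply: eq_of_polarization.
- have := hd _ (submodD pm px py); rewrite os_qD // (linearD theta) !hdotDl !hdotDr.
  rewrite !hd // -!addrA => /addrI; rewrite !addrA => /addIr.
  by rewrite (hdotC (q y)) tC.
- have piy : Ep ('i *: y) by exact: submodZ.
  have := hd _ (submodD pm px piy).
  rewrite os_qD // os_qZ // (linearD theta) (linearZ_LR theta) !hdotDl !hdotDr !hdotZl !hdotZr.
  rewrite !hd // -!addrA => /addrI; rewrite !addrA => /addIr.
  rewrite conjCi !mulNr (hdotC (q y)) tC => h2.
  by rewrite -opprB -[RHS]opprB; congr (- _); rewrite addrC h2 addrC.
Qed.

(* By the Markov property [theta x] and its projection [e] to [E0] have the
   same projection to [Ep], so [x - e] lies in the null space. *)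
Lemma os_q_zero x : Ep x -> exists2 e, E0 e & q e = q x.
Proof.
move=> px; pose e := orthoproj E0 (theta x).
have [e0 _] := orthoprojP (theta x) (@rp_zero_submod _ X) (@rp_zero_closed _ X).
rewrite -/e in e0; have [pe te] := e0; exists e => //.
have pm := rp_plus_submod X; have pc := @rp_plus_closed _ X.
have mx : orthoproj (@rp_minus R X) (theta x) = theta x.
  apply: orthoproj_eq; [exact: rp_minus_submod|exact: rp_minus_closed| |].
    by exists x.
  by move=> z _; rewrite subrr hdot0l.
have ee : orthoproj Ep e = e.
  by apply: orthoproj_eq => // z _; rewrite subrr hdot0l.
have := markov (theta x); rewrite mx -/e ee => eP.
have [_ ho] := orthoprojP (theta x) pm pc; rewrite -eP in ho.
apply/esym/eqP; rewrite -subr_eq0 -os_qB //; apply/eqP/hdot_eq0.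
have pd := submodB pm px pe.
by rewrite os_q_hdot // -rp_theta_hdot (linearB theta) te ho.
Qed.

Lemma os_q_zero_norm e : E0 e -> `|q e| = `|e|.
Proof. by move=> [pe te]; rewrite os_q_norm // te -norm_sqrtC. Qed.

(** The image of [E0] equals that of the positive space, hence is dense. It is also closed, because
    the quotient map is isometric on the complete space [E0]. *)
Lemma os_q_zero_surj (v : Q) : exists2 e, E0 e & q e = v.
Proof.
have /closure_normP cv : closure (q @` Ep) v by rewrite os_q_dense.
have /choice[e he] (n : nat) : exists e, E0 e /\ `|v - q e| <= n.+1%:R^-1.
  have [|_ [x px <-] hx] := cv n.+1%:R^-1; first by rewrite invr_gt0 ltr0n.
  by have [e e0 eE] := os_q_zero px; exists e; rewrite eE.
have qB m n : `|q (e m) - q (e n)| = `|e m - e n|.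
  have [[pm _] _] := he m; have [[pn _] _] := he n.
  rewrite -os_qB // os_q_zero_norm //; apply: submodB (he m).1 (he n).1.
  exact: rp_zero_submod.
have [|l hl] := @complete_seq _ X e.
  move=> d d0; have [|N hN] := @complex_archi _ (d / 2); first by rewrite divr_gt0.
  exists N => m n mN nN; rewrite -qB.
  have -> : q (e m) - q (e n) = (v - q (e n)) - (v - q (e m)).
    by rewrite opprB [RHS]addrC addrA subrK.
  apply: le_trans (ler_normB _ _) _; rewrite [leRHS](splitr d).
  by apply: lerD; apply: le_trans (he _).2 (hN _ _).
have l0 : E0 l.
  rewrite (closure_id E0).1; last exact: rp_zero_closed.
  apply/closure_normP => d /hl[N hN]; exists (e N); first exact: (he N).1.
  exact: hN.
exists l => //; apply/esym/eqP; rewrite -subr_eq0; apply/eqP.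
apply: (@norm_le_gt0_eq0 _ _ _ 2) => // d d0.
have [N1 h1] := hl d d0; have [N2 h2] := complex_archi d0.
pose n := maxn N1 N2.
have [pl _] := l0; have [[pn _] hn] := he n.
rewrite -(subrK (q (e n)) v) -addrA; apply: le_trans (ler_normD _ _) _.
rewrite mulr_natl mulr2n; apply: lerD.
  by apply: le_trans hn (h2 _ _); exact: leq_maxr.
rewrite -os_qB // os_q_zero_norm; last first.
  by apply: submodB (he n).1 l0; exact: rp_zero_submod.
by rewrite distrC; apply: h1; exact: leq_maxl.
Qed.

Theorem realization_unique (D : minimal_dilation C) :
  exists V : {linear X -> D}, dilation_equivalence U G V.
Proof.
have [G' GK G'K] := (realizes_unitary hU).2.
have /choice[j hj] (v : H) : exists e, E0 e /\ G (q e) = v.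
  by have [e e0 eE] := os_q_zero_surj (G' v); exists e; rewrite eE.
have j0 v : E0 (j v) by case: (hj v).
have Gj v : G (q (j v)) = v by case: (hj v).
have jG e : E0 e -> j (G (q e)) = e.
  move=> e0; apply/eqP; rewrite -subr_eq0 -normr_eq0.
  have j0' := j0 (G (q e)); have [pe _] := e0; have [pj _] := j0'.
  rewrite -os_q_zero_norm; last by apply: submodB j0' e0; exact: rp_zero_submod.
  by rewrite os_qB // (can_inj GK (Gj (G (q e)))) subrr normr0.
have pU t x : 0 <= t -> Ep x -> Ep (U t x).
  rewrite le_eqVlt => /predU1P[<-|t0] px; first by rewrite (unitary_group0 uU).
  exact: (rp_unitary_group_plus (realizes_group hU)).
(* Unitarity removes [U s]. As [j w] is fixed by [theta], the remaining product is the reflected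
   form, which the quotient turns into one involving [Uhat (t - s)], hence [C (t - s)]. *)
have gram_le s t v w : s <= t ->
    '[< U t (j v), U s (j w) >] = '[< C (t - s) v, w >].
  move=> st; have ts0 : 0 <= t - s by rewrite subr_ge0.
  have [pv _] := j0 v; have [pw tw] := j0 w.
  have -> : U t (j v) = U s (U (t - s) (j v)).
    by rewrite -(unitary_groupD uU) addrC subrK.
  rewrite (unitary_group_unitary uU s).1 -{1}tw -os_q_hdot //; last exact: pU.
  rewrite -(realizes_induced hU) // -(realizes_unitary hU).1.
  by rewrite (realizes_intertwines hU) // !Gj.
have gram s t v w :
    '[< U t (j v), U s (j w) >] = '[< C `|t - s| v, w >].
  have [st|/ltW ts] := leP s t; first by rewrite gram_le // ger0_norm ?subr_ge0.
  rewrite hdotC gram_le // ler0_norm ?subr_le0 // opprB.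
  rewrite -hdotC (contraction_semigroup_hermitian hC) //.
  by rewrite subr_ge0.
have rangeE : \bigcup_t (U t @` E0) = range (fun p : R * H => U p.1 (j p.2)).
  apply/seteqP; split=> [_ [t _ [e e0 <-]]|_ [[t v] _ <-]].
    by exists (t, G (q e)) => //=; rewrite jG.
  by exists t => //; exists (j v).
(* The sign matches [dil_U D t (ea 0 v) = ea (- t) v]; totality in [X] is cyclicity of [E0]. *)
have [|||V [uV VE]] := @isometry_extension R (R * H) X D
    (fun p => U p.1 (j p.2)) (fun p => dil_gen D (- p.1, p.2)).
- move=> [t v] [s w] /=; rewrite gram dil_hdot_gen /=.
  by rewrite opprK addrC.
- by rewrite -rangeE.
- rewrite -(dil_gen_total D); congr (closure (lspan _)).
  apply/seteqP; split=> [_ [[t v] _ <-]|_ [[t v] _ <-]].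
    by exists (- t, v).
  by exists (- t, v) => //=; rewrite opprK.
have nV := unitary_norm uV.
have Vj v : V (j v) = rkhs_ev_adj D 0 v.
  by have := VE (0, v); rewrite /= (unitary_group0 uU) /dil_gen /= oppr0.
(* Both sides are isometries, so agreement on the total family [U s (j v)] is enough; the same
   argument handles [theta]. *)
have VU t : V \o U t =1 dil_U D t \o V.
  apply: (@isometry_ext _ _ (V \o U t) (dil_U D t \o V)
    (range (fun p : R * H => U p.1 (j p.2)))).
  - by move=> x /=; rewrite nV (unitary_norm (unitary_group_unitary uU t)).
  - by move=> x /=; rewrite (unitary_norm (dil_U_unitary D t)) nV.
  - by rewrite -rangeE.
  move=> _ [[s v] _ <-] /=.
  rewrite -(unitary_groupD uU) (VE (t + s, v)) (VE (s, v)) /dil_gen /=.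
  by rewrite dil_U_gen opprD addrC.
have Vt : V \o theta =1 dil_theta D \o V.
  apply: (@isometry_ext _ _ (V \o theta) (dil_theta D \o V)
    (range (fun p : R * H => U p.1 (j p.2)))).
  - by move=> x /=; rewrite nV (unitary_norm (rp_theta_unitary X)).
  - by move=> x /=; rewrite (unitary_norm (dil_theta_unitary D)) nV.
  - by rewrite -rangeE.
  move=> _ [[s v] _ <-] /=; have [_ tv] := j0 v.
  have -> : theta (U s (j v)) = U (- s) (j v).
    by rewrite -(rp_unitary_group_theta (realizes_group hU)) tv.
  by rewrite (VE (- s, v)) (VE (s, v)) /dil_gen /= dil_theta_gen.
have V0 : V @` E0 = @dil_zero R H C D.
  apply/seteqP; split=> [_ [e e0 <-]|_ [v _ <-]].
    by exists (G (q e)) => //; rewrite /dil_emb -Vj jG.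
  by exists (j v) => //; rewrite Vj.
exists V; split=> //.
  rewrite generated unitary_image_clspan // /dil_plus -V0.
  congr (closure (lspan _)).
  apply/seteqP; split=> [_ [_ [t t0 [e e0 <-]] <-]|_ [t t0 [_ [e e0 <-] <-]]].
    by exists t => //; exists (V e); [exists e|have /= -> := VU t e].
  by exists (U t e); [exists t => //; exists e|exact: VU].
by move=> x x0; rewrite /dil_emb -Vj jG.
Qed.

End Uniqueness.

(** The clause [inhabited (minimal_dilation C)] keeps the final quantification over [D] from being
    vacuous; existence is witnessed by the dilation itself. *)
Theorem proposition4p3p5 (R : realType) (H : hilbertType R)
    (C : R -> {linear H -> H}) (hC : contraction_semigroup C) :
  (exists (X : rp_space R) (U : R -> {linear X -> X}),
      euclidean_realization C U /\ markov_type X /\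
      zero_cyclic U /\ plus_generated U) /\
  inhabited (minimal_dilation C) /\
  (forall (X : rp_space R) (U : R -> {linear X -> X}) (Q : os_quotient X)
      (Uhat : R -> {linear Q -> Q}) (G : {linear Q -> H}),
    realizes C U Uhat G -> markov_type X ->
    zero_cyclic U -> plus_generated U ->
    forall D : minimal_dilation C,
      exists V : {linear X -> D}, dilation_equivalence U G V).
Proof.
have [D] := minimal_dilation_exists hC; split; last split.
- exists (dil_rp hC D), (dil_U D); split; first exact: dil_rp_realizes.
  split; first exact: dil_rp_markov.
  by split; [exact: dil_rp_cyclic|exact: dil_rp_generated].
- by constructor.
- move=> X U Q Uhat G hU markov cyclic generated D'.
  exact: (realization_unique hC hU markov cyclic generated).
Qed.
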